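(* Let $M\in\mathbb{N}^*$, $\mathcal{L}_M=\{0,\dots,M\}$, $x_0\in\mathcal{L}_M$, $y_0\in\mathbb{N}$. Let $\lambda:\mathbb{R}_+\times\mathcal{L}_M\to\mathbb{R}_+$ be such that $t\mapsto\lambda(t,x)$ is càdlàg for every $x$, $\lambda(t,M)=0$ for all $t\ge 0$, and $\lambda$ is bounded on $[0,T]\times\mathcal{L}_M$ for every $T>0$. Let $f:\mathbb{R}\to\mathbb{R}$ be continuous with $0<\underline{f}\le f(x)\le\bar f<\infty$ for all $x$. Let $(\mu^k_{ij})_{i,j\ge 0}$, $k\in\mathcal{L}_M$, be intensity matrices satisfying: $\mu^k_{ij}\ge 0$ for $i\ne j$; $\mu^k_{ii}\le 0$; $\sum_{j\ge0}\mu^k_{ij}=0$ for all $i$; and $\sup_{i\in\mathbb{N}}|\mu^k_{ii}|<\infty$ for every $k$. Then the equation $P'(t)=\Psi(t,P(t))$, $P(0)=P_0$, admits a unique solution $P$ on $\mathbb{R}_+$ satisfying $P(t)\ge 0$ (componentwise) and $|P(t)|=1$ for all $t\ge 0$, where $\Psi$ and $P_0$ are as described in the context.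
   Context: Let $E$ be the set of real families $u=(u^i_j)_{0\le i\le M,\,j\ge 0}$, $E_+$ the subset with all $u^i_j\ge 0$, $E_+^*$ the subset with all $u^i_j>0$, and $|u|=\sum_{i=0}^M\sum_{j\ge0}|u^i_j|$; solutions are sought among summable families, i.e. $P(t)$ with $|P(t)|<\infty$. $P_0\in E$ is given by $(P_0)^{x_0}_{y_0}=1$ and $(P_0)^i_j=0$ for $(i,j)\ne(x_0,y_0)$. For $x\in E_+$ and $i\in\mathcal{L}_M$ set $\varphi(x,i)=\frac{\sum_{l\ge0}f(l)x^i_l}{\sum_{l\ge0}x^i_l}$, and define $\Psi:\mathbb{R}_+\times E_+\to E$ by $$(\Psi(t,x))^i_j=\sum_{k\ge0}\mu^i_{kj}x^i_k+\mathbf{1}_{\{i\ge1\}}\frac{\lambda(t,i-1)}{\varphi(x,i-1)}f(j)\,x^{i-1}_j-\mathbf{1}_{\{i\le M-1\}}\frac{\lambda(t,i)}{\varphi(x,i)}f(j)\,x^i_j,$$ where, when $x^i_l=0$ for all $l$ (so that $\varphi(x,i)$ is undefined), the terms $\frac{x^i_j}{\varphi(x,i)}$ are set equal to $0$ (the continuous extension from $E_+^*$, using $\underline f\le\varphi\le\bar f$ there). This equation is the Fokker–Planck equation for $p(t,i,j)=\mathbb{P}(X_t=i,Y_t=j)$ of a stochastic local intensity model where the loss counter $X$ jumps by $+1$ at rate $\lambda(t,X_t)f(Y_t)/\mathbb{E}[f(Y_t)\mid X_t]$ and $Y$ is a Markov chain on $\mathbb{N}$ with transition rates $\mu^{X_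t}_{ij}$.
   Formalization: Since λ is only càdlàg in t, P'(t)=Ψ(t,P(t)) can fail at jump times of λ; the equation is therefore read componentwise in integrated form, P(t)=P_0+∫_0^t Ψ(s,P(s))ds for all t≥0, with uniqueness among such P having P(t)≥0 and |P(t)|=1. *)

(* Defs.v *)
From Stdlib Require Import Reals Arith ClassicalDescription.
From Coquelicot Require Import Coquelicot.
Open Scope R_scope.

(* A family u = (u^i_j)_{0<=i<=M, j>=0} is represented as u : nat -> nat -> R,
   with u i j = u^i_j; only indices i <= M are meaningful. *)
Definition lfamily := nat -> nat -> R.

Definition fam_norm (M : nat) (u : lfamily) : R :=
  sum_f_R0 (fun i => Series (fun j => Rabs (u i j))) M.

Definition fam_summable (M : nat) (u : lfamily) : Prop :=
  forall i, (i <= M)%nat -> ex_series (fun j => Rabs (u i j)).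

Definition P0 (x0 y0 : nat) : lfamily :=
  fun i j => if andb (Nat.eqb i x0) (Nat.eqb j y0) then 1 else 0.

Definition phi (f : R -> R) (x : lfamily) (i : nat) : R :=
  Series (fun l => f (INR l) * x i l) / Series (fun l => x i l).

Definition ratio (f : R -> R) (x : lfamily) (i j : nat) : R :=
  if excluded_middle_informative (forall l, x i l = 0) then 0
  else x i j / phi f x i.

Definition Psi (M : nat) (lam : R -> nat -> R) (f : R -> R)
  (mu : nat -> nat -> nat -> R) (t : R) (x : lfamily) : lfamily :=
  fun i j =>
    Series (fun k => mu i k j * x i k)
    + (if (1 <=? i)%nat then lam t (i - 1)%nat * ratio f x (i - 1)%nat j * f (INR j) else 0)
    - (if (i <=? M - 1)%nat then lam t i * ratio f x i j * f (INR j) else 0).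

(* P solves P' = Psi(t,P), P(0) = P0 on R_+ (in integrated form, componentwise):
   P(t)^i_j = P0^i_j + int_0^t Psi(s,P(s))^i_j ds for all t >= 0. *)
Definition is_solution (M : nat) (lam : R -> nat -> R) (f : R -> R)
  (mu : nat -> nat -> nat -> R) (x0 y0 : nat) (P : R -> lfamily) : Prop :=
  forall t, 0 <= t -> forall i j, (i <= M)%nat ->
    is_RInt (fun s => Psi M lam f mu s (P s) i j) 0 t (P t i j - P0 x0 y0 i j).

Definition is_prob_path (M : nat) (P : R -> lfamily) : Prop :=
  forall t, 0 <= t ->
    (forall i j, (i <= M)%nat -> 0 <= P t i j) /\
    fam_summable M (P t) /\ fam_norm M (P t) = 1.

(* Main.v *)
(** On nonnegative families [x f / phi] equals [x * (S / F)] with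
    [S = sum_l x_l] and [F = sum_l f(l) x_l >= fl * S], so it is globally
    Lipschitz in the l1 norm, up to and including [x = 0]. Hence
    [x |-> Psi (t, x^+)], with [x^+] the componentwise positive part, is
    Lipschitz on the whole space, locally uniformly in [t], and Picard iteration
    gives a global solution. A component of that solution has a nonnegative
    derivative whenever it is negative, so it stays nonnegative and solves the
    original equation. Càdlàg coefficients enter only through Riemann
    integrability. *)

Require Import Defs.
From Stdlib Require Import Reals Lra Lia ClassicalEpsilon ClassicalDescription.
From Coquelicot Require Import Coquelicot.
Open Scope R_scope.

(** * Summable sequences *)

(** Norm bounds are phrased through partial sums. [l1_le u B] gives absolute summability and the
    bound at once, and it survives pointwise limits and time integration because each instance
    involves finitely many components; sequence-valued integrals and exchanges of a series with an
    integral are thereby avoided. Families are measured by the largest norm over the levels, so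
    every estimate concerns one sequence at a time. The delicate point at zero is that S / F alone
    need not be continuous there. Its variation is controlled only after multiplication by the
    lighter of the two families compared. Conservation of mass rests on two cancellations, rows of
    rate matrices summing to zero and fluxes telescoping over the levels. Uniqueness concerns
    arbitrary probability paths, with no time regularity beyond the integral equation: nonnegativity
    lets [Psi] itself be compared along both paths, and unit mass supplies the a priori bound from
    which the contraction starts. *)

Definition l1_le (u : nat -> R) (B : R) : Prop :=
  forall N, sum_f_R0 (fun j => Rabs (u j)) N <= B.

Definition l1_summable (u : nat -> R) : Prop := exists B, l1_le u B.

Lemma l1_le_nonneg u B : l1_le u B -> 0 <= B.
Proof. intros H. generalize (H 0%nat) (Rabs_pos (u 0%nat)). simpl. lra. Qed.

Lemma l1_le_comp u B j : l1_le u B -> Rabs (u j) <= B.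
Proof.
  intros H. generalize (H j). destruct j as [|j]; simpl; [lra|].
  generalize (cond_pos_sum (fun j => Rabs (u j)) j (fun n => Rabs_pos (u n))).
  lra.
Qed.

Lemma l1_le_abs_le u v B :
  (forall j, Rabs (v j) <= Rabs (u j)) -> l1_le u B -> l1_le v B.
Proof.
  intros H Hu N. apply Rle_trans with (2 := Hu N).
  apply sum_Rle; intros; apply H.
Qed.

Lemma l1_le_ext u v B : (forall j, u j = v j) -> l1_le u B -> l1_le v B.
Proof.
  intros H. apply l1_le_abs_le. intros j. rewrite H. apply Rle_refl.
Qed.

Lemma l1_le_weaken u B C : B <= C -> l1_le u B -> l1_le u C.
Proof. intros H Hu N. generalize (Hu N). lra. Qed.

Lemma l1_le_plus u v B C :
  l1_le u B -> l1_le v C -> l1_le (fun j => u j + v j) (B + C).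
Proof.
  intros Hu Hv N.
  apply Rle_trans with (sum_f_R0 (fun j => Rabs (u j) + Rabs (v j)) N).
  - apply sum_Rle; intros; apply Rabs_triang.
  - rewrite plus_sum. generalize (Hu N) (Hv N). lra.
Qed.

Lemma l1_le_mult w u c B :
  0 <= c -> (forall j, Rabs (w j) <= c) -> l1_le u B ->
  l1_le (fun j => w j * u j) (c * B).
Proof.
  intros Hc Hw Hu N.
  apply Rle_trans with (sum_f_R0 (fun j => Rabs (u j) * c) N).
  - apply sum_Rle; intros n _. rewrite Rabs_mult, Rmult_comm.
    apply Rmult_le_compat_l; [apply Rabs_pos | apply Hw].
  - rewrite <- scal_sum. apply Rmult_le_compat_l; auto.
Qed.

Lemma l1_le_minus u v B C :
  l1_le u B -> l1_le v C -> l1_le (fun j => u j - v j) (B + C).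
Proof.
  intros Hu Hv. apply (l1_le_plus u (fun j => - v j)); auto.
  apply l1_le_abs_le with (2 := Hv). intros j. rewrite Rabs_Ropp. lra.
Qed.

Lemma l1_le_ex_series u B : l1_le u B -> ex_series (fun j => Rabs (u j)).
Proof.
  intros Hu.
  destruct (ex_finite_lim_seq_incr (sum_f_R0 (fun j => Rabs (u j))) B) as [l Hl].
  - intros n. simpl. generalize (Rabs_pos (u (S n))). lra.
  - exact Hu.
  - exists l. change (is_lim_seq (sum_n (fun j => Rabs (u j))) l).
    apply is_lim_seq_ext with (2 := Hl).
    intros n. symmetry. apply sum_n_Reals.
Qed.

Lemma is_series_lim_seq (u : nat -> R) (l : R) :
  is_series u l -> is_lim_seq (sum_f_R0 u) l.
Proof.
  intros H. apply (is_lim_seq_ext (sum_n u)); auto.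
  intros n. apply sum_n_Reals.
Qed.

Lemma ex_series_l1_le u :
  ex_series (fun j => Rabs (u j)) -> l1_le u (Series (fun j => Rabs (u j))).
Proof.
  intros H N. apply (is_lim_seq_incr_compare (sum_f_R0 (fun j => Rabs (u j)))).
  - apply is_series_lim_seq, Series_correct, H.
  - intros n. simpl. generalize (Rabs_pos (u (S n))). lra.
Qed.

Lemma Series_le_bound u B :
  ex_series u -> (forall N, sum_f_R0 u N <= B) -> Series u <= B.
Proof.
  intros Hu HB.
  apply (is_lim_seq_le (sum_f_R0 u) (fun _ => B) (Series u) B); auto.
  - apply is_series_lim_seq, Series_correct, Hu.
  - apply is_lim_seq_const.
Qed.

Lemma Series_nonneg u : ex_series u -> (forall j, 0 <= u j) -> 0 <= Series u.
Proof.
  intros Hu Hp.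
  apply (is_lim_seq_le (fun _ => 0) (sum_f_R0 u) 0 (Series u)).
  - intros n. apply cond_pos_sum, Hp.
  - apply is_lim_seq_const.
  - apply is_series_lim_seq, Series_correct, Hu.
Qed.

Lemma l1_le_Series u B : l1_le u B -> Rabs (Series u) <= B.
Proof.
  intros Hu. pose proof (l1_le_ex_series _ _ Hu) as He.
  apply Rle_trans with (1 := Series_Rabs _ He).
  apply Series_le_bound; auto.
Qed.

Lemma l1_summable_ex_series u : l1_summable u -> ex_series u.
Proof. intros [B H]. apply ex_series_Rabs, (l1_le_ex_series _ _ H). Qed.

Lemma l1_summable_mult w u c :
  (forall j, Rabs (w j) <= c) -> l1_summable u -> l1_summable (fun j => w j * u j).
Proof.
  intros Hw [B Hu]. exists (c * B). apply l1_le_mult; auto.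
  generalize (Hw 0%nat) (Rabs_pos (w 0%nat)). lra.
Qed.

Lemma is_series_single (c : R) (k : nat) :
  is_series (fun j => if Nat.eqb j k then c else 0) c.
Proof.
  assert (Hz : forall n, (n < k)%nat ->
    sum_f_R0 (fun j => if Nat.eqb j k then c else 0) n = 0).
  { intros n Hn. apply sum_eq_R0. intros m Hm.
    destruct (Nat.eqb_spec m k); [lia | reflexivity]. }
  assert (Hk : forall n, (k <= n)%nat ->
    sum_f_R0 (fun j => if Nat.eqb j k then c else 0) n = c).
  { intros n Hn. induction Hn as [|n Hn IH].
    - destruct k as [|k]; simpl; auto.
      rewrite (Hz k) by lia. rewrite Nat.eqb_refl. ring.
    - rewrite tech5, IH. destruct (Nat.eqb_spec (S n) k); [lia | ring]. }
  apply is_series_Reals. intros eps Heps. exists k. intros n Hn.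
  rewrite Hk by lia. unfold Rdist. rewrite Rminus_diag, Rabs_R0. exact Heps.
Qed.

Lemma is_series_sum_f_R0 (a : nat -> nat -> R) (l : nat -> R) N :
  (forall j, is_series (a j) (l j)) ->
  is_series (fun k => sum_f_R0 (fun j => a j k) N) (sum_f_R0 l N).
Proof.
  intros H. induction N as [|N IH]; simpl; auto.
  apply (is_series_plus _ _ _ _ IH (H (S N))).
Qed.

Lemma is_lim_seq_sum_f_R0 (a : nat -> nat -> R) (l : nat -> R) N :
  (forall j, is_lim_seq (fun k => a k j) (l j)) ->
  is_lim_seq (fun k => sum_f_R0 (a k) N) (sum_f_R0 l N).
Proof.
  intros H. induction N as [|N IH]; simpl; auto.
  apply is_lim_seq_plus'; auto.
Qed.

(** A Fatou-type statement: for fixed [N] only finitely many coordinates pass to the limit. It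
    transfers the uniform estimates on the iterates to their componentwise limit. *)
Lemma l1_le_lim (u : nat -> nat -> R) (v : nat -> R) B :
  (forall j, is_lim_seq (fun k => u k j) (v j)) ->
  (forall k, l1_le (u k) B) -> l1_le v B.
Proof.
  intros Hl Hu N.
  apply (is_lim_seq_le (fun k => sum_f_R0 (fun j => Rabs (u k j)) N)
    (fun _ => B) (sum_f_R0 (fun j => Rabs (v j)) N) B).
  - intros k. apply Hu.
  - apply (is_lim_seq_sum_f_R0 (fun k j => Rabs (u k j)) (fun j => Rabs (v j))).
    intros j. apply (is_lim_seq_abs _ (v j)), Hl.
  - apply is_lim_seq_const.
Qed.

Lemma is_RInt_sum_f_R0 (g : R -> nat -> R) (u : nat -> R) a b N :
  (forall j, is_RInt (fun s => g s j) a b (u j)) ->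
  is_RInt (fun s => sum_f_R0 (g s) N) a b (sum_f_R0 u N).
Proof.
  intros H. induction N as [|N IH]; simpl; auto.
  apply (is_RInt_plus _ _ _ _ _ _ IH (H (S N))).
Qed.

(** The norm of an integral is at most the integral of a majorant [h] of the norm. For fixed [N],
    inserting the signs [sg] of the integrals [u j] turns the partial sum into the integral of a
    finite signed sum, which is at most [h]; the norm of [g s] itself is never integrated. *)
Lemma l1_le_RInt (g : R -> nat -> R) (h : R -> R) (u : nat -> R) H a b :
  a <= b ->
  (forall j, is_RInt (fun s => g s j) a b (u j)) ->
  is_RInt h a b H ->
  (forall s, a < s < b -> l1_le (g s) (h s)) ->
  l1_le u H.
Proof.
  intros Hab Hg Hh Hle N.
  set (sg := fun j => if Rle_dec 0 (u j) then 1 else -1).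
  replace (sum_f_R0 (fun j => Rabs (u j)) N)
    with (sum_f_R0 (fun j => sg j * u j) N).
  2:{ apply sum_eq. intros j _. unfold sg.
      destruct (Rle_dec 0 (u j)).
      - rewrite Rabs_pos_eq; auto; ring.
      - rewrite Rabs_left; lra. }
  apply (is_RInt_le (fun s => sum_f_R0 (fun j => sg j * g s j) N) h a b); auto.
  - apply (is_RInt_sum_f_R0 (fun s j => sg j * g s j) (fun j => sg j * u j)).
    intros j. apply (is_RInt_scal _ _ _ (sg j) _ (Hg j)).
  - intros s Hs. apply Rle_trans with (2 := Hle s Hs N).
    apply sum_Rle. intros j _. apply Rle_trans with (1 := Rle_abs _).
    rewrite Rabs_mult. unfold sg.
    destruct (Rle_dec 0 (u j)); [rewrite Rabs_R1 | rewrite Rabs_m1]; lra.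
Qed.

(** * Regulated functions are Riemann integrable *)

(** This class contains the càdlàg coefficients and is stable under sums and products. The left
    limit at 0 is left out because only the half-line matters. *)
Definition regulated (g : R -> R) : Prop :=
  (forall t, 0 <= t -> exists l : R, filterlim g (at_right t) (locally l)) /\
  (forall t, 0 < t -> exists l : R, filterlim g (at_left t) (locally l)).

Lemma regulated_const c : regulated (fun _ => c).
Proof. split; intros t _; exists c; apply filterlim_const. Qed.

Lemma regulated_plus g h :
  regulated g -> regulated h -> regulated (fun s => g s + h s).
Proof.
  intros [Hg1 Hg2] [Hh1 Hh2]; split; intros t Ht.
  - destruct (Hg1 t Ht) as [l Hl], (Hh1 t Ht) as [m Hm]. exists (l + m).
    apply (filterlim_comp_2 _ _ Rplus Hl Hm), (@filterlim_plus _ R_NormedModule).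
  - destruct (Hg2 t Ht) as [l Hl], (Hh2 t Ht) as [m Hm]. exists (l + m).
    apply (filterlim_comp_2 _ _ Rplus Hl Hm), (@filterlim_plus _ R_NormedModule).
Qed.

Lemma regulated_minus g h :
  regulated g -> regulated h -> regulated (fun s => g s - h s).
Proof.
  intros Hg [Hh1 Hh2]. apply (regulated_plus g (fun s => - h s)); auto.
  split; intros t Ht.
  - destruct (Hh1 t Ht) as [m Hm]. exists (- m).
    apply (filterlim_comp _ _ _ _ Ropp _ _ _ Hm), (@filterlim_opp _ R_NormedModule).
  - destruct (Hh2 t Ht) as [m Hm]. exists (- m).
    apply (filterlim_comp _ _ _ _ Ropp _ _ _ Hm), (@filterlim_opp _ R_NormedModule).
Qed.

Lemma regulated_mult g h :
  regulated g -> regulated h -> regulated (fun s => g s * h s).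
Proof.
  intros [Hg1 Hg2] [Hh1 Hh2]; split; intros t Ht.
  - destruct (Hg1 t Ht) as [l Hl], (Hh1 t Ht) as [m Hm]. exists (l * m).
    apply (filterlim_comp_2 _ _ Rmult Hl Hm), (@filterlim_mult R_AbsRing).
  - destruct (Hg2 t Ht) as [l Hl], (Hh2 t Ht) as [m Hm]. exists (l * m).
    apply (filterlim_comp_2 _ _ Rmult Hl Hm), (@filterlim_mult R_AbsRing).
Qed.

Definition locally_lipschitz (g : R -> R) : Prop :=
  forall T, 0 < T -> exists K, forall s t, 0 <= s <= t -> t <= T ->
    Rabs (g t - g s) <= K * (t - s).

Lemma regulated_lipschitz g : locally_lipschitz g -> regulated g.
Proof.
  intros Hg.
  assert (Hcont : forall t (eps : posreal), 0 <= t -> exists d : posreal,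
    forall s, 0 <= s -> Rabs (s - t) < d -> Rabs (g s - g t) < eps).
  { intros t eps Ht. destruct (Hg (t + 1)) as [K HK]; [lra|].
    assert (HK' : 0 < Rabs K + 1) by (generalize (Rabs_pos K); lra).
    assert (Hd : 0 < Rmin 1 (eps / (Rabs K + 1))).
    { apply Rmin_glb_lt; [lra|]. apply Rdiv_lt_0_compat; [apply eps | auto]. }
    exists (mkposreal _ Hd). intros s Hs Hst. simpl in Hst.
    assert (H1 : Rabs (s - t) < 1) by (apply Rlt_le_trans with (1 := Hst), Rmin_l).
    assert (H2 : Rabs (s - t) * (Rabs K + 1) < eps).
    { apply Rlt_div_r; auto. apply Rlt_le_trans with (1 := Hst), Rmin_r. }
    apply Rle_lt_trans with (2 := H2).
    apply Rle_trans with (Rabs (s - t) * K).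
    - destruct (Rle_dec s t) as [Hle|Hle].
      + rewrite (Rabs_minus_sym (g s)), (Rabs_minus_sym s), (Rabs_pos_eq (t - s)),
          Rmult_comm by lra. apply HK; lra.
      + rewrite (Rabs_pos_eq (s - t)), Rmult_comm by lra. apply HK; try lra.
        generalize (Rle_abs (s - t)). lra.
    - apply Rmult_le_compat_l; [apply Rabs_pos|]. generalize (Rle_abs K). lra. }
  split; intros t Ht; exists (g t); apply filterlim_locally; intros eps;
    destruct (Hcont t eps) as [d Hd]; try lra.
  - exists d. intros s Hs Hts. apply Hd; [lra | exact Hs].
  (* The radius is also kept below [t], so that [s] stays positive, where the Lipschitz bound is
     available. *)
  - assert (Hm : 0 < Rmin d t) by (apply Rmin_glb_lt; [apply d | auto]).
    exists (mkposreal _ Hm). intros s Hs Hts.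
    assert (Hs' : Rabs (s - t) < Rmin d t) by exact Hs.
    apply Hd.
    + assert (Rabs (s - t) < t) by (apply Rlt_le_trans with (1 := Hs'), Rmin_r).
      rewrite Rabs_left in H; lra.
    + apply Rlt_le_trans with (1 := Hs'), Rmin_l.
Qed.

Definition approximable (g : R -> R) (eps a c : R) : Prop :=
  exists h, ex_RInt h a c /\ forall x, a <= x <= c -> Rabs (g x - h x) <= eps.

(** The approximant is continued by the constant [l] on the open interval and by the value of [g] at
    the point [d]. A single point does not affect the integral, so nothing is required of [g] at
    [d]. *)
Lemma approximable_extend g eps a c d l :
  0 <= eps -> a <= c < d ->
  approximable g eps a c ->
  (forall x, c < x < d -> Rabs (g x - l) <= eps) ->
  approximable g eps a d.
Proof.
  intros Heps Hcd [h [Hh Hgh]] Hl.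
  exists (fun x => if Rle_dec x c then h x else if Rlt_dec x d then l else g x).
  split.
  - apply ex_RInt_Chasles with c.
    + apply ex_RInt_ext with (2 := Hh). intros x Hx.
      rewrite Rmin_left, Rmax_right in Hx by lra.
      destruct (Rle_dec x c); [auto | lra].
    + apply ex_RInt_ext with (fun _ => l); [|apply ex_RInt_const].
      intros x Hx. rewrite Rmin_left, Rmax_right in Hx by lra.
      destruct (Rle_dec x c); [lra|]. destruct (Rlt_dec x d); [auto | lra].
  - intros x Hx. destruct (Rle_dec x c); [apply Hgh; lra|].
    destruct (Rlt_dec x d); [apply Hl; lra|].
    rewrite Rminus_diag, Rabs_R0. auto.
Qed.

(** Continuous induction on the right endpoint: let [c] be the supremum of the endpoints reachable
    from 0. The left limit at [c] shows that [c] itself is reached, and the right limit would allow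
    going beyond [c] if [c < b]. *)
Lemma regulated_approximable g eps b :
  regulated g -> 0 < eps -> 0 <= b -> approximable g eps 0 b.
Proof.
  intros [Hr Hl] Heps Hb.
  assert (Happ0 : approximable g eps 0 0).
  { exists g. split; [apply ex_RInt_point|].
    intros x _. rewrite Rminus_diag, Rabs_R0. lra. }
  destruct (completeness (fun c => 0 <= c <= b /\ approximable g eps 0 c))
    as [c [Hub Hlub]].
  { exists b. intros x [Hx _]. lra. }
  { exists 0. split; [lra | auto]. }
  assert (Hc0 : 0 <= c) by (apply Hub; split; [lra | auto]).
  assert (Hcb : c <= b) by (apply Hlub; intros x [Hx _]; lra).
  assert (Hc : approximable g eps 0 c).
  { destruct (Rle_lt_or_eq_dec 0 c Hc0) as [Hpos|<-]; auto.
    destruct (Hl c Hpos) as [l Hlim].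
    apply (proj1 (filterlim_locally _ _)) with (eps := mkposreal eps Heps) in Hlim.
    destruct Hlim as [d Hd].
    (* Either a reachable endpoint lies in the left neighbourhood where [g] is close to [l], or [c]
       is itself reachable; failing both, [Rmax 0 (c - d)] would be a smaller upper bound. *)
    destruct (classic (exists x, c - d < x /\ x < c /\ 0 <= x /\ approximable g eps 0 x))
      as [(x & Hx1 & Hx2 & Hx3 & Hx4)|Hno].
    - apply approximable_extend with x l; auto; try lra.
      intros y Hy. left. apply (Hd y); [|lra].
      change (Rabs (y - c) < d). rewrite Rabs_left; lra.
    - destruct (classic (approximable g eps 0 c)) as [|Hnc]; auto.
      exfalso. generalize (cond_pos d); intros Hdp.
      assert (c <= Rmax 0 (c - d)).
      { apply Hlub. intros x [Hx Hax].
        destruct (Rle_dec x (c - d)) as [Hxd|Hxd].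
        - apply Rle_trans with (1 := Hxd), Rmax_r.
        - exfalso. apply Hno. exists x. repeat split; try lra; auto.
          assert (Hxc : x <= c) by (apply Hub; split; auto).
          destruct (Rle_lt_or_eq_dec x c Hxc) as [|He]; auto.
          subst x. contradiction. }
      revert H. apply Rmax_case; lra. }
  destruct (Rle_lt_or_eq_dec c b Hcb) as [Hlt|<-]; auto.
  exfalso. destruct (Hr c Hc0) as [l Hlim].
  apply (proj1 (filterlim_locally _ _)) with (eps := mkposreal eps Heps) in Hlim.
  destruct Hlim as [d Hd]. generalize (cond_pos d); intros Hdp.
  assert (Hm : c < Rmin b (c + d)) by (apply Rmin_glb_lt; lra).
  assert (Hm1 : Rmin b (c + d) <= c + d) by apply Rmin_r.
  apply (Rlt_not_le _ _ Hm), Hub. split.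
  - split; [lra | apply Rmin_l].
  - apply approximable_extend with c l; auto; try lra.
    intros y Hy. left. apply (Hd y); [|lra].
    change (Rabs (y - c) < d). rewrite Rabs_pos_eq; lra.
Qed.

Lemma approximable_ex_RInt g a b :
  a <= b -> (forall eps, 0 < eps -> approximable g eps a b) -> ex_RInt g a b.
Proof.
  intros Hab Happ.
  assert (Ha : forall n, approximable g (/ INR (S n)) a b).
  { intros n. apply Happ, Rinv_0_lt_compat, lt_0_INR; lia. }
  set (h := fun n => proj1_sig (constructive_indefinite_description _ (Ha n))).
  assert (Hh : forall n, ex_RInt (h n) a b /\
    forall x, a <= x <= b -> Rabs (g x - h n x) <= / INR (S n)).
  { intros n. exact (proj2_sig (constructive_indefinite_description _ (Ha n))). }
  (* [filterlim_RInt] wants uniform convergence on the whole line. *)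
  set (h' := fun n x => if Rle_dec a x then if Rle_dec x b then h n x else g x else g x).
  assert (Hint : forall n, is_RInt (h' n) a b (RInt (h n) a b)).
  { intros n. apply is_RInt_ext with (h n).
    - intros x Hx. rewrite Rmin_left, Rmax_right in Hx by lra. unfold h'.
      destruct (Rle_dec a x); [|lra]. destruct (Rle_dec x b); [auto | lra].
    - apply (RInt_correct (h n)), Hh. }
  destruct (filterlim_RInt h' a b eventually _ g (fun n => RInt (h n) a b) Hint)
    as [I [_ HI]].
  - apply filterlim_locally. intros eps.
    destruct (archimed_cor1 eps (cond_pos eps)) as [N [HN HN0]].
    exists N. intros n Hn x. change (Rabs (h' n x - g x) < eps).
    rewrite Rabs_minus_sym.
    assert (Hin : a <= x <= b -> Rabs (g x - h n x) < eps).
    { intros Hx. apply Rle_lt_trans with (1 := proj2 (Hh n) x Hx).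
      apply Rle_lt_trans with (2 := HN). apply Rinv_le_contravar.
      - apply lt_0_INR; lia.
      - apply le_INR; lia. }
    assert (Hout : Rabs (g x - g x) < eps)
      by (rewrite Rminus_diag, Rabs_R0; apply eps).
    unfold h'. destruct (Rle_dec a x); auto. destruct (Rle_dec x b); auto.
  - exists I. exact HI.
Qed.

Lemma regulated_ex_RInt g a b : regulated g -> 0 <= a <= b -> ex_RInt g a b.
Proof.
  intros Hg Hab. apply (@ex_RInt_Chasles_2 R_CompleteNormedModule) with 0; [lra|].
  apply approximable_ex_RInt; [lra|].
  intros eps Heps. apply regulated_approximable; auto; lra.
Qed.

(** * Picard iteration in the supremum over levels of the l1 norm *)

Definition level_le (M : nat) (u : lfamily) (B : R) : Prop :=
  forall i, (i <= M)%nat -> l1_le (u i) B.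

Definition level_summable (M : nat) (u : lfamily) : Prop :=
  exists B, level_le M u B.

Definition fam_minus (u v : lfamily) : lfamily := fun i j => u i j - v i j.

Definition lipschitz_on (M : nat) (G : R -> lfamily -> lfamily) (T L : R) : Prop :=
  forall t x y B, 0 <= t <= T ->
    level_summable M x -> level_summable M y ->
    level_le M (fam_minus x y) B ->
    level_le M (fam_minus (G t x) (G t y)) (L * B).

(** Vanishing at the zero family turns the Lipschitz estimate into the linear growth bound that
    keeps the iterates summable. *)
Definition lipschitz_field (M : nat) (G : R -> lfamily -> lfamily) : Prop :=
  (forall T, 0 < T -> exists L, 0 <= L /\ lipschitz_on M G T L) /\
  (forall t i j, (i <= M)%nat -> G t (fun _ _ => 0) i j = 0).

Definition lipschitz_path (M : nat) (x : R -> lfamily) : Prop :=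
  forall T, 0 < T -> exists K,
    (forall s t, 0 <= s <= t -> t <= T ->
      level_le M (fam_minus (x t) (x s)) (K * (t - s))) /\
    (forall t, 0 <= t <= T -> level_le M (x t) K).

(** The graph of the Picard map: [y] is the image of [x], and solutions are its fixed points,
    [integrates M G u0 x x]. A relation keeps the integrability of the field along [x] inside the
    statement. *)
Definition integrates (M : nat) (G : R -> lfamily -> lfamily) (u0 : lfamily)
  (x y : R -> lfamily) : Prop :=
  forall t i j, 0 <= t -> (i <= M)%nat ->
    is_RInt (fun s => G s (x s) i j) 0 t (y t i j - u0 i j).

(** Integrability is asked along Lipschitz paths only: the Picard map preserves this class, and the
    limit of the iterates stays in it. *)
Definition integrable_field (M : nat) (G : R -> lfamily -> lfamily) : Prop :=
  forall x, lipschitz_path M x -> forall i j t, (i <= M)%nat -> 0 <= t ->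
    ex_RInt (fun s => G s (x s) i j) 0 t.

Lemma level_le_nonneg M u B : level_le M u B -> 0 <= B.
Proof. intros H. apply (l1_le_nonneg (u 0%nat)), H; lia. Qed.

Lemma level_le_weaken M u B C : B <= C -> level_le M u B -> level_le M u C.
Proof. intros H Hu i Hi. apply l1_le_weaken with (1 := H), Hu, Hi. Qed.

Lemma level_le_trans M u v w B C :
  level_le M (fam_minus u v) B -> level_le M (fam_minus v w) C ->
  level_le M (fam_minus u w) (B + C).
Proof.
  intros Hu Hv i Hi.
  apply (l1_le_ext (fun j => fam_minus u v i j + fam_minus v w i j)).
  - intros j. unfold fam_minus. ring.
  - apply l1_le_plus; auto.
Qed.

Lemma level_le_shift M u v B C :
  level_le M (fam_minus u v) B -> level_le M v C -> level_le M u (C + B).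
Proof.
  intros Hu Hv i Hi.
  apply (l1_le_ext (fun j => v i j + fam_minus u v i j)).
  - intros j. unfold fam_minus. ring.
  - apply l1_le_plus; auto.
Qed.

Lemma lipschitz_path_summable M x t :
  lipschitz_path M x -> 0 <= t -> level_summable M (x t).
Proof.
  intros Hx Ht. destruct (Hx (t + 1)) as [K [_ HK]]; [lra|].
  exists K. apply HK. lra.
Qed.

Lemma lipschitz_path_const M u : level_summable M u -> lipschitz_path M (fun _ => u).
Proof.
  intros [B HB] T HT. exists B. split; auto.
  intros s t Hst _ i Hi. apply l1_le_weaken with 0.
  - apply Rmult_le_pos; [apply (level_le_nonneg _ _ _ HB) | lra].
  - intros N. right. apply sum_eq_R0. intros. unfold fam_minus.
    rewrite Rminus_diag. apply Rabs_R0.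
Qed.

Lemma integrates_increment M G u0 x y s t i j :
  integrates M G u0 x y -> 0 <= s <= t -> (i <= M)%nat ->
  is_RInt (fun r => G r (x r) i j) s t (y t i j - y s i j).
Proof.
  intros H Hst Hi.
  replace (y t i j - y s i j)
    with (plus (opp (y s i j - u0 i j)) (y t i j - u0 i j))
    by (unfold plus, opp; simpl; ring).
  apply (@is_RInt_Chasles R_NormedModule) with 0.
  - apply (@is_RInt_swap R_NormedModule), H; auto; lra.
  - apply H; auto; lra.
Qed.

Lemma integrates_initial M G u0 x y i j :
  integrates M G u0 x y -> (i <= M)%nat -> y 0 i j = u0 i j.
Proof.
  intros H Hi.
  pose proof (is_RInt_unique _ _ _ _ (H 0 i j (Rle_refl 0) Hi)) as H1.
  rewrite RInt_point in H1. unfold zero in H1; simpl in H1. lra.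
Qed.

(** Written with the antiderivative [c / 2 * exp (2 * L * s)], hence without division by [L]; the
    case [L = 0] is included. *)
Lemma is_RInt_exp L c t :
  is_RInt (fun s => L * (c * exp (2 * L * s))) 0 t (c / 2 * (exp (2 * L * t) - 1)).
Proof.
  replace (c / 2 * (exp (2 * L * t) - 1))
    with (minus (c / 2 * exp (2 * L * t)) (c / 2 * exp (2 * L * 0))).
  - apply (is_RInt_derive (fun s => c / 2 * exp (2 * L * s))).
    + intros x _. auto_derive; auto. field.
    + intros x _. apply (ex_derive_continuous (fun s => L * (c * exp (2 * L * s)))).
      auto_derive. auto.
  - unfold minus, plus, opp; simpl. rewrite Rmult_0_r, exp_0. ring.
Qed.

Lemma level_le_increment M G u0 x y L B T s t :
  integrates M G u0 x y ->
  (forall r, 0 <= r <= T -> level_le M (G r (x r)) (L * B)) ->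
  0 <= s <= t -> t <= T ->
  level_le M (fam_minus (y t) (y s)) (L * B * (t - s)).
Proof.
  intros Hy HB Hst HtT i Hi.
  apply (l1_le_RInt (fun r => G r (x r) i) (fun _ => L * B) _ _ s t); [lra | | |].
  - intros j. apply integrates_increment with (1 := Hy); auto.
  - rewrite (Rmult_comm (L * B)). apply (is_RInt_const s t (L * B)).
  - intros r Hr. apply HB; auto. lra.
Qed.

(* The weight [exp (2 L t)] makes integration of an [L]-Lipschitz field a
   contraction with factor 1/2 on every bounded interval. *)
Lemma weighted_contraction M G u0 x y x' y' L T c :
  integrates M G u0 x x' -> integrates M G u0 y y' ->
  (forall s B, 0 <= s <= T -> level_le M (fam_minus (x s) (y s)) B ->
    level_le M (fam_minus (G s (x s)) (G s (y s))) (L * B)) ->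
  (forall s, 0 <= s <= T ->
    level_le M (fam_minus (x s) (y s)) (c * exp (2 * L * s))) ->
  forall t, 0 <= t <= T ->
    level_le M (fam_minus (x' t) (y' t)) (c / 2 * exp (2 * L * t)).
Proof.
  intros Hx Hy HL Hc t Ht i Hi.
  assert (Hc0 : 0 <= c).
  { assert (H0 : 0 <= 0 <= T) by lra.
    generalize (level_le_nonneg _ _ _ (Hc 0 H0)). rewrite Rmult_0_r, exp_0. lra. }
  apply l1_le_weaken with (c / 2 * (exp (2 * L * t) - 1)); [lra|].
  apply (l1_le_RInt (fun s => fam_minus (G s (x s)) (G s (y s)) i)
    (fun s => L * (c * exp (2 * L * s))) _ _ 0 t); [lra | | |].
  - intros j. unfold fam_minus.
    replace (x' t i j - y' t i j)
      with (minus (x' t i j - u0 i j) (y' t i j - u0 i j))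
      by (unfold minus, plus, opp; simpl; ring).
    apply (is_RInt_minus (fun s => G s (x s) i j) (fun s => G s (y s) i j)).
    + apply Hx; auto; lra.
    + apply Hy; auto; lra.
  - apply is_RInt_exp.
  - intros s Hs. apply HL; auto; [lra|]. apply Hc. lra.
Qed.

Lemma geom_le_zero r E : (forall n, r <= E * (1 / 2) ^ n) -> r <= 0.
Proof.
  intros H.
  apply (is_lim_seq_le (fun _ => r) (fun n => E * (1 / 2) ^ n) r 0); auto.
  - apply is_lim_seq_const.
  - replace (Finite 0) with (Rbar_mult E 0) by (simpl; f_equal; ring).
    apply is_lim_seq_scal_l, is_lim_seq_geom. rewrite Rabs_pos_eq; lra.
Qed.

(** Both paths are fixed points of the Picard map, so the weighted contraction applied to the pair
    itself halves the bound on their distance as often as desired. The Lipschitz estimate is asked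
    only along the two paths, which allows a field that is Lipschitz merely on nonnegative
    families. *)
Lemma integral_solution_unique M G u0 x y L T B :
  integrates M G u0 x x -> integrates M G u0 y y ->
  (forall s B, 0 <= s <= T -> level_le M (fam_minus (x s) (y s)) B ->
    level_le M (fam_minus (G s (x s)) (G s (y s))) (L * B)) ->
  0 <= L ->
  (forall s, 0 <= s <= T -> level_le M (fam_minus (x s) (y s)) B) ->
  forall t i j, 0 <= t <= T -> (i <= M)%nat -> x t i j = y t i j.
Proof.
  intros Hx Hy HL HL0 HB t i j Ht Hi.
  assert (Hn : forall n s, 0 <= s <= T ->
    level_le M (fam_minus (x s) (y s)) (B * (1 / 2) ^ n * exp (2 * L * s))).
  { induction n as [|n IH]; intros s Hs.
    - apply level_le_weaken with (2 := HB s Hs).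
      assert (HB0 := level_le_nonneg _ _ _ (HB s Hs)).
      assert (1 <= exp (2 * L * s)).
      { apply Rle_trans with (1 + 2 * L * s).
        - assert (0 <= L * s) by (apply Rmult_le_pos; lra). lra.
        - apply exp_ineq1_le. }
      simpl. rewrite Rmult_1_r. rewrite <- (Rmult_1_r B) at 1.
      apply Rmult_le_compat_l; lra.
    - replace (B * (1 / 2) ^ S n) with (B * (1 / 2) ^ n / 2) by (simpl; field).
      apply weighted_contraction with (1 := Hx) (2 := Hy) (T := T); auto. }
  assert (Hz : Rabs (x t i j - y t i j) <= 0).
  { apply geom_le_zero with (B * exp (2 * L * t)). intros n.
    replace (B * exp (2 * L * t) * (1 / 2) ^ n)
      with (B * (1 / 2) ^ n * exp (2 * L * t)) by ring.
    apply (l1_le_comp (fam_minus (x t) (y t) i)), Hn; auto. }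
  generalize (Rabs_pos (x t i j - y t i j)); intros Hp.
  assert (Ha : Rabs (x t i j - y t i j) = 0) by lra.
  destruct (Req_dec (x t i j - y t i j) 0) as [He|He]; [lra|].
  now apply Rabs_no_R0 in He.
Qed.

(** * Picard iterates and their limit *)

Fixpoint picard (G : R -> lfamily -> lfamily) (u0 : lfamily) (n : nat)
  : R -> lfamily :=
  match n with
  | O => fun _ => u0
  | S n => fun t i j => u0 i j + RInt (fun s => G s (picard G u0 n s) i j) 0 t
  end.

Lemma lipschitz_field_bound M G T L t x B :
  lipschitz_field M G -> lipschitz_on M G T L -> 0 <= t <= T ->
  level_le M x B -> level_le M (G t x) (L * B).
Proof.
  intros [_ HG0] HL Ht Hx i Hi.
  apply (l1_le_ext (fam_minus (G t x) (G t (fun _ _ => 0)) i)).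
  - intros j. unfold fam_minus. rewrite HG0; auto. ring.
  - apply HL; auto.
    + exists B. exact Hx.
    + exists 0. intros k _ N. right. apply sum_eq_R0. intros. apply Rabs_R0.
    + intros k Hk. apply (l1_le_ext (x k)); [|apply Hx, Hk].
      intros j. unfold fam_minus. ring.
Qed.

Lemma lipschitz_path_integrates M G u0 x y :
  lipschitz_field M G -> level_summable M u0 ->
  lipschitz_path M x -> integrates M G u0 x y -> lipschitz_path M y.
Proof.
  intros HG [B0 HB0] Hx Hy T HT.
  destruct (proj1 HG T HT) as [L [HL0 HL]]. destruct (Hx T HT) as [K [_ HK]].
  assert (HK0 : 0 <= K).
  { apply (level_le_nonneg M (x 0)), HK. lra. }
  assert (HB00 := level_le_nonneg _ _ _ HB0).
  assert (HLK : 0 <= L * K) by (apply Rmult_le_pos; auto).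
  assert (HLKT : 0 <= L * K * T) by (apply Rmult_le_pos; lra).
  assert (Hinc : forall s t, 0 <= s <= t -> t <= T ->
    level_le M (fam_minus (y t) (y s)) (L * K * (t - s))).
  { intros s t Hst HtT. apply level_le_increment with (1 := Hy) (T := T); auto.
    intros r Hr. apply lipschitz_field_bound with T; auto. }
  (* One constant serves twice: it dominates the Lipschitz constant [L * K] and the size bound
     [B0 + L * K * T]. *)
  exists (B0 + L * K + L * K * T). split.
  - intros s t Hst HtT. apply level_le_weaken with (2 := Hinc s t Hst HtT).
    apply Rmult_le_compat_r; lra.
  - intros t Ht. apply level_le_weaken with (B0 + L * K * (t - 0)).
    + assert (L * K * t <= L * K * T) by (apply Rmult_le_compat_l; lra).
      rewrite Rminus_0_r. lra.
    + apply level_le_shift with u0; auto. intros i Hi.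
      apply (l1_le_ext (fam_minus (y t) (y 0) i)); [|apply Hinc; auto; lra].
      intros j. unfold fam_minus. now rewrite (integrates_initial _ _ _ _ _ _ _ Hy).
Qed.

Lemma picard_integrates M G u0 n :
  lipschitz_field M G -> integrable_field M G -> level_summable M u0 ->
  lipschitz_path M (picard G u0 n) /\
  integrates M G u0 (picard G u0 n) (picard G u0 (S n)).
Proof.
  intros HG HI Hu0.
  assert (Hint : forall n, lipschitz_path M (picard G u0 n) ->
    integrates M G u0 (picard G u0 n) (picard G u0 (S n))).
  { clear n. intros n Hn t i j Ht Hi. simpl.
    rewrite Rplus_minus_l.
    apply (RInt_correct (fun s => G s (picard G u0 n s) i j)), HI; auto. }
  induction n as [|n [IH1 IH2]].
  - split; [|apply Hint]; apply lipschitz_path_const, Hu0.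
  - assert (H : lipschitz_path M (picard G u0 (S n)))
      by (apply lipschitz_path_integrates with (4 := IH2); auto).
    auto.
Qed.

(** The first increment is at most [K * T], with [K] the Lipschitz constant of the first iterate,
    which starts at [u0]. Each later one gains a factor 1/2 in the weighted norm, and bounding the
    weight by [exp (2 * L * T)] gives [E]. *)
Lemma picard_increment M G u0 T :
  lipschitz_field M G -> integrable_field M G -> level_summable M u0 -> 0 < T ->
  exists E, forall n t, 0 <= t <= T ->
    level_le M (fam_minus (picard G u0 (S n) t) (picard G u0 n t)) (E * (1 / 2) ^ n).
Proof.
  intros HG HI Hu0 HT.
  destruct (proj1 HG T HT) as [L [HL0 HL]].
  assert (Hp := fun n => picard_integrates M G u0 n HG HI Hu0).
  destruct (proj1 (Hp 1%nat) T HT) as [K [HK _]].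
  assert (HK0 : 0 <= K).
  { destruct (Hp 1%nat) as [H1 _].
    assert (H : 0 <= K * (T - 0)).
    { apply level_le_nonneg with (1 := HK 0 T ltac:(lra) ltac:(lra)). }
    apply Rmult_le_reg_r with T; lra. }
  assert (Hexp : forall a b, 0 <= a <= b -> exp (2 * L * a) <= exp (2 * L * b)).
  { intros a b Hab. destruct (Rle_lt_or_eq_dec (2 * L * a) (2 * L * b)) as [H|H].
    - apply Rmult_le_compat_l; lra.
    - left. apply exp_increasing, H.
    - rewrite H. lra. }
  assert (Hw : forall n t, 0 <= t <= T ->
    level_le M (fam_minus (picard G u0 (S n) t) (picard G u0 n t))
      (K * T * (1 / 2) ^ n * exp (2 * L * t))).
  { induction n as [|n IH]; intros t Ht.
    - apply level_le_weaken with (K * (t - 0)).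
      + assert (1 <= exp (2 * L * t)).
        { rewrite <- exp_0. rewrite <- (Rmult_0_r (2 * L)). apply Hexp; lra. }
        assert (K * t <= K * T) by (apply Rmult_le_compat_l; lra).
        assert (0 <= K * T) by (apply Rmult_le_pos; lra).
        assert (K * T * 1 <= K * T * exp (2 * L * t))
          by (apply Rmult_le_compat_l; lra).
        simpl. rewrite Rminus_0_r, Rmult_1_r. lra.
      + intros i Hi.
        apply (l1_le_ext (fam_minus (picard G u0 1 t) (picard G u0 1 0) i));
          [|apply HK; auto; lra].
        intros j. unfold fam_minus.
        now rewrite (integrates_initial _ _ _ _ _ _ _ (proj2 (Hp 0%nat)) Hi).
    - replace (K * T * (1 / 2) ^ S n) with (K * T * (1 / 2) ^ n / 2)
        by (simpl; field).
      apply weighted_contraction with (1 := proj2 (Hp (S n))) (2 := proj2 (Hp n))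
        (T := T); auto.
      intros s B Hs HB. apply HL; auto;
        apply lipschitz_path_summable; try apply Hp; apply Hs. }
  exists (K * T * exp (2 * L * T)). intros n t Ht.
  apply level_le_weaken with (2 := Hw n t Ht).
  replace (K * T * exp (2 * L * T) * (1 / 2) ^ n)
    with (K * T * (1 / 2) ^ n * exp (2 * L * T)) by ring.
  apply Rmult_le_compat_l.
  - apply Rmult_le_pos; [apply Rmult_le_pos; lra | apply pow_le; lra].
  - apply Hexp. lra.
Qed.

Lemma picard_cauchy M G u0 T :
  lipschitz_field M G -> integrable_field M G -> level_summable M u0 -> 0 < T ->
  exists E, forall n k t, 0 <= t <= T ->
    level_le M (fam_minus (picard G u0 (k + n) t) (picard G u0 n t)) (E * (1 / 2) ^ n).
Proof.
  intros HG HI Hu0 HT.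
  destruct (picard_increment M G u0 T HG HI Hu0 HT) as [E HE].
  exists (2 * E). intros n k t Ht.
  assert (HE0 : 0 <= E).
  { generalize (level_le_nonneg _ _ _ (HE 0%nat t Ht)). simpl. lra. }
  assert (Hp : forall m, 0 <= (1 / 2) ^ m) by (intros m; apply pow_le; lra).
  (* The exact value of the finite geometric sum is kept, since the final bound alone would not pass
     through the induction on [k]. *)
  apply level_le_weaken with (2 * E * ((1 / 2) ^ n - (1 / 2) ^ (k + n))).
  - apply Rmult_le_compat_l; [lra|]. generalize (Hp (k + n)%nat). lra.
  - induction k as [|k IH].
    + intros i Hi N. right. rewrite Rminus_diag, Rmult_0_r.
      apply sum_eq_R0. intros. unfold fam_minus. simpl.
      rewrite Rminus_diag. apply Rabs_R0.
    + replace (2 * E * ((1 / 2) ^ n - (1 / 2) ^ (S k + n)))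
        with (E * (1 / 2) ^ (k + n) + 2 * E * ((1 / 2) ^ n - (1 / 2) ^ (k + n)))
        by (simpl; field).
      apply level_le_trans with (picard G u0 (k + n) t); auto. apply HE, Ht.
Qed.

Definition picard_limit (G : R -> lfamily -> lfamily) (u0 : lfamily) : R -> lfamily :=
  fun t i j => real (Lim_seq (fun n => picard G u0 n t i j)).

Lemma picard_limit_correct M G u0 t i j :
  lipschitz_field M G -> integrable_field M G -> level_summable M u0 ->
  0 <= t -> (i <= M)%nat ->
  is_lim_seq (fun n => picard G u0 n t i j) (picard_limit G u0 t i j).
Proof.
  intros HG HI Hu0 Ht Hi. apply Lim_seq_correct', ex_lim_seq_cauchy_corr.
  destruct (picard_cauchy M G u0 (t + 1) HG HI Hu0) as [E HE]; [lra|].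
  assert (Hc : forall n k,
    Rabs (picard G u0 (k + n) t i j - picard G u0 n t i j) <= E * (1 / 2) ^ n).
  { intros n k. apply (l1_le_comp (fam_minus _ _ i)), HE; auto. lra. }
  assert (Hlim : is_lim_seq (fun n => E * (1 / 2) ^ n) 0).
  { replace (Finite 0) with (Rbar_mult E 0) by (simpl; f_equal; ring).
    apply is_lim_seq_scal_l, is_lim_seq_geom. rewrite Rabs_pos_eq; lra. }
  intros eps. apply is_lim_seq_spec in Hlim.
  destruct (Hlim (pos_div_2 eps)) as [N HN]. exists N. intros n m Hn Hm.
  specialize (HN N (le_n N)). simpl in HN.
  assert (Hb := Rle_abs (E * (1 / 2) ^ N - 0)).
  assert (H1 := Hc N (n - N)%nat). assert (H2 := Hc N (m - N)%nat).
  replace (n - N + N)%nat with n in H1 by lia.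
  replace (m - N + N)%nat with m in H2 by lia.
  rewrite Rabs_minus_sym in H2.
  replace (picard G u0 n t i j - picard G u0 m t i j)
    with ((picard G u0 n t i j - picard G u0 N t i j) +
          (picard G u0 N t i j - picard G u0 m t i j)) by ring.
  apply Rle_lt_trans with (1 := Rabs_triang _ _). lra.
Qed.

(** The limit inherits a uniform Lipschitz bound from the iterates. This must come before the
    integral equation, because it is what makes the field integrable along the limit. *)
Lemma integral_solution_exists M G u0 :
  lipschitz_field M G -> integrable_field M G -> level_summable M u0 ->
  exists x, lipschitz_path M x /\ integrates M G u0 x x.
Proof.
  intros HG HI Hu0.
  assert (Hp := fun n => picard_integrates M G u0 n HG HI Hu0).
  assert (Hlim := fun t i j => picard_limit_correct M G u0 t i j HG HI Hu0).
  set (P := picard_limit G u0) in *.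
  assert (Hclose : forall T, 0 < T -> exists E, forall n t, 0 <= t <= T ->
    level_le M (fam_minus (P t) (picard G u0 n t)) (E * (1 / 2) ^ n)).
  { intros T HT. destruct (picard_cauchy M G u0 T HG HI Hu0 HT) as [E HE].
    exists E. intros n t Ht i Hi.
    apply l1_le_lim with
      (u := fun k => fam_minus (picard G u0 (k + n) t) (picard G u0 n t) i).
    - intros j. unfold fam_minus. apply is_lim_seq_minus'.
      + apply (is_lim_seq_incr_n (fun k => picard G u0 k t i j)), Hlim; auto. lra.
      + apply is_lim_seq_const.
    - intros k. apply HE; auto. }
  assert (Hlip : lipschitz_path M P).
  { intros T HT. destruct (picard_cauchy M G u0 T HG HI Hu0 HT) as [E HE].
    destruct Hu0 as [B0 HB0].
    destruct (proj1 HG T HT) as [L [HL0 HL]].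
    assert (HB00 := level_le_nonneg _ _ _ HB0).
    assert (Hb : forall n t, 0 <= t <= T -> level_le M (picard G u0 n t) (B0 + E)).
    { intros n t Ht. apply level_le_shift with u0; auto.
      generalize (HE 0%nat n t Ht). rewrite Nat.add_0_r. simpl.
      now rewrite Rmult_1_r. }
    assert (HBE : 0 <= B0 + E).
    { apply (level_le_nonneg M (picard G u0 0 0)), Hb. lra. }
    assert (HLB : 0 <= L * (B0 + E)) by (apply Rmult_le_pos; auto).
    exists (L * (B0 + E) + (B0 + E)). split.
    - intros s t Hst HtT i Hi.
      apply l1_le_weaken with (L * (B0 + E) * (t - s)).
      { apply Rmult_le_compat_r; lra. }
      (* The index is shifted by one because the increments of iterate [S k] are controlled by the
         size of iterate [k]. *)
      apply l1_le_lim with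
        (u := fun k => fam_minus (picard G u0 (S k) t) (picard G u0 (S k) s) i).
      + intros j. unfold fam_minus. apply is_lim_seq_minus'.
        * apply (is_lim_seq_incr_1 (fun k => picard G u0 k t i j)), Hlim; auto. lra.
        * apply (is_lim_seq_incr_1 (fun k => picard G u0 k s i j)), Hlim; auto. lra.
      + intros k. apply level_le_increment with (1 := proj2 (Hp k)) (T := T); auto.
        intros r Hr. apply lipschitz_field_bound with T; auto.
    - intros t Ht i Hi. apply l1_le_weaken with (B0 + E); [lra|].
      apply l1_le_lim with (u := fun k => picard G u0 k t i).
      + intros j. apply Hlim; auto. lra.
      + intros k. apply Hb; auto. }
  exists P. split; auto. intros t i j Ht Hi.
  pose proof (RInt_correct (fun s => G s (P s) i j) 0 t (HI P Hlip i j t Hi Ht)) as HR.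
  replace (P t i j - u0 i j) with (RInt (fun s => G s (P s) i j) 0 t); auto.
  set (I := fun j => RInt (fun s => G s (P s) i j) 0 t). change (I j = P t i j - u0 i j).
  destruct (Hclose (t + 1)) as [E HE]; [lra|].
  destruct (proj1 HG (t + 1)) as [L [HL0 HL]]; [lra|].
  (* The increment of iterate [S n] is the integral of the field along iterate [n], so it differs
     from [I] by the integral of a field difference of size at most [L * (E * (1 / 2) ^ n)]. *)
  assert (Hn : forall n,
    Rabs (picard G u0 (S n) t i j - u0 i j - I j) <= t * (L * E) * (1 / 2) ^ n).
  { intros n. rewrite Rabs_minus_sym.
    apply (l1_le_comp (fun j => I j - (picard G u0 (S n) t i j - u0 i j))).
    apply (l1_le_RInt (fun s => fam_minus (G s (P s)) (G s (picard G u0 n s)) i)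
      (fun _ => L * (E * (1 / 2) ^ n)) _ _ 0 t); auto.
    - intros k. apply (is_RInt_minus (fun s => G s (P s) i k)).
      + apply (RInt_correct (fun s => G s (P s) i k)), HI; auto.
      + apply Hp; auto.
    - replace (t * (L * E) * (1 / 2) ^ n) with ((t - 0) * (L * (E * (1 / 2) ^ n)))
        by ring.
      apply (is_RInt_const 0 t (L * (E * (1 / 2) ^ n))).
    - intros s Hs. apply HL; auto; try lra.
      + apply lipschitz_path_summable; auto; lra.
      + apply lipschitz_path_summable; [apply Hp | lra].
      + apply HE. lra. }
  assert (Hz : Rabs (P t i j - u0 i j - I j) <= 0).
  { apply geom_le_zero with (t * (L * E) + E). intros n.
    replace (P t i j - u0 i j - I j)
      with ((P t i j - picard G u0 (S n) t i j) +
            (picard G u0 (S n) t i j - u0 i j - I j)) by ring.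
    apply Rle_trans with (1 := Rabs_triang _ _).
    assert (H1 : Rabs (P t i j - picard G u0 (S n) t i j) <= E * (1 / 2) ^ S n).
    { apply (l1_le_comp (fam_minus _ _ i)), HE; auto. lra. }
    assert (HEn : 0 <= E * (1 / 2) ^ S n).
    { apply Rle_trans with (2 := H1), Rabs_pos. }
    generalize (Hn n). simpl in *. lra. }
  apply Rabs_le_between in Hz. lra.
Qed.

(** * The coefficients of the equation *)

Definition rate_matrix (m : nat -> nat -> R) (C : R) : Prop :=
  (forall k j, k <> j -> 0 <= m k j) /\
  (forall k, m k k <= 0) /\
  (forall k, is_series (m k) 0) /\
  (forall k, Rabs (m k k) <= C).

(** The generator acting on measures: [u] as a row vector multiplied by the matrix [m]. *)
Definition rate_image (m : nat -> nat -> R) (u : nat -> R) : nat -> R :=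
  fun j => Series (fun k => m k j * u k).

(** Taking absolute values changes only the diagonal entry, by [2 * Rabs (m k k)]; as the row sums
    to zero, this is its whole l1 norm. *)
Lemma rate_matrix_row m C k : rate_matrix m C -> l1_le (m k) (2 * C).
Proof.
  intros (Hoff & Hdiag & Hrow & HC).
  assert (Hs : is_series (fun j => Rabs (m k j)) (0 + 2 * Rabs (m k k))).
  { apply is_series_ext with
      (fun j => plus (m k j) (if Nat.eqb j k then 2 * Rabs (m k k) else 0)).
    - intros j. unfold plus; simpl. destruct (Nat.eqb_spec j k) as [->|Hj].
      + rewrite Rabs_left1 by apply Hdiag. ring.
      + rewrite Rabs_pos_eq by auto. ring.
    - apply (is_series_plus (m k) _ _ _ (Hrow k)), is_series_single. }
  apply l1_le_weaken with (Series (fun j => Rabs (m k j))).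
  - rewrite (is_series_unique _ _ Hs). generalize (HC k). lra.
  - apply ex_series_l1_le. exists (0 + 2 * Rabs (m k k)). exact Hs.
Qed.

Lemma rate_image_summable m C u j :
  rate_matrix m C -> l1_summable u -> l1_summable (fun k => m k j * u k).
Proof.
  intros Hm Hu. apply l1_summable_mult with (2 * C); auto.
  intros k. apply l1_le_comp, rate_matrix_row, Hm.
Qed.

(** Only a finite sum over [j] is exchanged with the series over [k]; the row bound [2 * C] then
    applies to the inner sum for each [k]. *)
Lemma l1_le_rate_image m C u B :
  rate_matrix m C -> l1_le u B -> l1_le (rate_image m u) (2 * C * B).
Proof.
  intros Hm Hu N.
  assert (Hu' : l1_summable u) by (exists B; auto).
  assert (HC : 0 <= 2 * C) by (apply (l1_le_nonneg (m 0%nat)), rate_matrix_row, Hm).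
  assert (Hs : forall j, ex_series (fun k => Rabs (m k j * u k))).
  { intros j. destruct (rate_image_summable m C u j Hm Hu') as [D HD].
    apply l1_le_ex_series with (1 := HD). }
  assert (Hsum := is_series_sum_f_R0 (fun j k => Rabs (m k j * u k)) _ N
    (fun j => Series_correct _ (Hs j))).
  apply Rle_trans with (sum_f_R0 (fun j => Series (fun k => Rabs (m k j * u k))) N).
  - apply sum_Rle. intros j _. apply Series_Rabs, Hs.
  - rewrite <- (is_series_unique _ _ Hsum). apply Series_le_bound.
    + eexists. exact Hsum.
    + intros K.
      apply Rle_trans with (sum_f_R0 (fun k => Rabs (u k) * (2 * C)) K).
      * apply sum_Rle. intros k _.
        rewrite (sum_eq _ (fun j => Rabs (m k j) * Rabs (u k)))
          by (intros; apply Rabs_mult).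
        rewrite <- scal_sum. apply Rmult_le_compat_l; [apply Rabs_pos|].
        apply rate_matrix_row, Hm.
      * rewrite <- scal_sum. apply Rmult_le_compat_l; auto.
Qed.

Lemma rate_image_minus m C u v j :
  rate_matrix m C -> l1_summable u -> l1_summable v ->
  rate_image m (fun k => u k - v k) j = rate_image m u j - rate_image m v j.
Proof.
  intros Hm Hu Hv. unfold rate_image. rewrite <- Series_minus.
  - apply Series_ext. intros k. ring.
  - apply l1_summable_ex_series, rate_image_summable with C; auto.
  - apply l1_summable_ex_series, rate_image_summable with C; auto.
Qed.

(** Dominated convergence for series: the bounded weights are handled by pointwise convergence on a
    finite head and by summability of [u] on the tail. *)
Lemma Series_dominated (w : nat -> nat -> R) u c :
  (forall k, is_lim_seq (fun N => w N k) 0) ->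
  (forall N k, Rabs (w N k) <= c) -> l1_summable u ->
  is_lim_seq (fun N => Series (fun k => w N k * u k)) 0.
Proof.
  intros Hw Hc [B Hu]. apply is_lim_seq_spec. intros eps.
  pose proof (l1_le_ex_series _ _ Hu) as Hex.
  assert (Hc0 : 0 <= c) by (generalize (Hc 0%nat 0%nat) (Rabs_pos (w 0%nat 0%nat)); lra).
  (* A tail of [u] below this value contributes less than [eps / 2] once multiplied by [c]; the
     added 1 covers [c = 0]. *)
  assert (Hd : 0 < eps / (2 * (c + 1))).
  { apply Rdiv_lt_0_compat; [apply eps | lra]. }
  pose proof (is_series_lim_seq _ _ (Series_correct _ Hex)) as Hlim.
  apply is_lim_seq_spec in Hlim. destruct (Hlim (mkposreal _ Hd)) as [K HK].
  specialize (HK K (le_n K)). simpl in HK.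
  set (tl := Series (fun k => Rabs (u (S K + k)%nat))).
  assert (Htl : Series (fun j => Rabs (u j)) = sum_f_R0 (fun j => Rabs (u j)) K + tl).
  { apply (Series_incr_n (fun j => Rabs (u j)) (S K)); auto. lia. }
  rewrite Htl in HK.
  assert (Htl0 : 0 <= tl).
  { apply Series_nonneg; [|intros; apply Rabs_pos].
    apply (ex_series_incr_n (fun k => Rabs (u k)) (S K)), Hex. }
  assert (Htle : c * tl < eps / 2).
  { rewrite Rabs_minus_sym, Rplus_minus_l, Rabs_pos_eq in HK by auto.
    apply (Rmult_lt_compat_l (c + 1)) in HK; [|lra].
    replace ((c + 1) * (eps / (2 * (c + 1)))) with (eps / 2) in HK by (field; lra).
    lra. }
  assert (Hfin : is_lim_seq (fun N => sum_f_R0 (fun k => w N k * u k) K) 0).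
  { replace 0 with (sum_f_R0 (fun _ => 0) K) by (apply sum_eq_R0; auto).
    apply (is_lim_seq_sum_f_R0 (fun N k => w N k * u k) (fun _ => 0)).
    intros k. replace 0 with (0 * u k) by ring.
    apply is_lim_seq_mult'; [apply Hw | apply is_lim_seq_const]. }
  apply is_lim_seq_spec in Hfin. destruct (Hfin (pos_div_2 eps)) as [N0 HN0].
  exists N0. intros N HN. specialize (HN0 N HN). simpl in HN0.
  rewrite Rminus_0_r in *.
  assert (Hwu : l1_summable (fun k => w N k * u k)).
  { apply l1_summable_mult with c; auto. exists B. exact Hu. }
  rewrite (Series_incr_n _ (S K)); [|lia | apply l1_summable_ex_series, Hwu].
  apply Rle_lt_trans with (1 := Rabs_triang _ _).
  assert (Htail : Rabs (Series (fun k => w N (S K + k)%nat * u (S K + k)%nat)) <= c * tl).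
  { apply l1_le_Series.
    apply (l1_le_mult (fun k => w N (S K + k)%nat) (fun k => u (S K + k)%nat)); auto.
    apply ex_series_l1_le, (ex_series_incr_n (fun k => Rabs (u k)) (S K)), Hex. }
  unfold Init.Nat.pred. lra.
Qed.

(** Jumps of the chain preserve mass within a level. The partial sum over [j] equals the series of
    [u k] weighted by a partial row sum; these weights tend to 0 and are bounded by [2 * C], so
    dominated convergence applies. *)
Lemma is_series_rate_image m C u :
  rate_matrix m C -> l1_summable u -> is_series (rate_image m u) 0.
Proof.
  intros Hm Hu.
  assert (Hlim : is_lim_seq (fun N => Series (fun k => sum_f_R0 (m k) N * u k)) 0).
  { apply Series_dominated with (2 * C); auto.
    - intros k. apply is_series_lim_seq, Hm.
    - intros N k. apply Rle_trans with (1 := Rsum_abs _ _).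
      apply rate_matrix_row, Hm. }
  change (is_lim_seq (sum_n (rate_image m u)) 0).
  apply is_lim_seq_ext with (2 := Hlim). intros N. rewrite sum_n_Reals.
  apply is_series_unique.
  apply is_series_ext with (fun k => sum_f_R0 (fun j => m k j * u k) N).
  - intros k. rewrite (Rmult_comm _ (u k)), scal_sum. reflexivity.
  - apply (is_series_sum_f_R0 (fun j k => m k j * u k)). intros j.
    apply Series_correct, l1_summable_ex_series, rate_image_summable with C; auto.
Qed.

(** * The reciprocal of the conditional mean and its Lipschitz estimate *)

Definition inv_avg (w u : nat -> R) : R := Series u / Series (fun l => w l * u l).

(** Removes the case distinction in [ratio]: at a zero level the factor [x i j] already gives 0. The
    inverse being total, no denominator has to be shown nonzero. *)
Lemma ratio_inv_avg f x i j :
  ratio f x i j = x i j * inv_avg (fun l => f (INR l)) (x i).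
Proof.
  unfold ratio, inv_avg, phi. change (Series (fun l => x i l)) with (Series (x i)).
  destruct (excluded_middle_informative (forall l, x i l = 0)) as [H|H].
  - rewrite H. ring.
  - unfold Rdiv. rewrite Rinv_mult, Rinv_inv. ring.
Qed.

Definition bounded_weight (w : nat -> R) (fl fu : R) : Prop :=
  0 < fl /\ forall l, fl <= w l <= fu.

Lemma bounded_weight_abs w fl fu l : bounded_weight w fl fu -> Rabs (w l) <= fu.
Proof. intros [H0 H]. generalize (H l). intros. rewrite Rabs_pos_eq; lra. Qed.

Lemma weighted_Series_ge w fl fu u :
  bounded_weight w fl fu -> l1_summable u -> (forall j, 0 <= u j) ->
  fl * Series u <= Series (fun l => w l * u l).
Proof.
  intros Hw Hu Hp. rewrite <- Series_scal_l. apply Series_le.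
  - intros n. split.
    + apply Rmult_le_pos; auto. destruct Hw; lra.
    + apply Rmult_le_compat_r; auto. apply Hw.
  - apply l1_summable_ex_series, l1_summable_mult with fu; auto.
    intros j. apply bounded_weight_abs with fl, Hw.
Qed.

Lemma div_bound fl S F : 0 < fl -> 0 <= S -> fl * S <= F -> 0 <= S / F <= / fl.
Proof.
  intros Hfl HS HF. destruct (Rle_lt_or_eq_dec 0 S HS) as [HS'|<-].
  - assert (0 < fl * S) by (apply Rmult_lt_0_compat; auto).
    split.
    + apply Rlt_le, Rdiv_lt_0_compat; lra.
    + apply Rle_div_l; [lra|]. apply Rmult_le_reg_l with fl; auto.
      replace (fl * (/ fl * F)) with F by (field; lra). lra.
  - unfold Rdiv. rewrite Rmult_0_l. generalize (Rinv_0_lt_compat _ Hfl). lra.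
Qed.

(** The factor [Sv] compensates the singularity of the quotients at zero: the product splits into
    [Sv / Fu * (Su - Sv)] and [Sv / Fv * (Sv / Fu) * (Fv - Fu)]. Every quotient here is at most
    [/ fl]; for [Sv / Fu] this uses [Sv <= Su]. *)
Lemma div_lipschitz fl fu Su Fu Sv Fv D :
  0 < fl -> 0 <= fu -> 0 <= Sv <= Su -> fl * Su <= Fu -> fl * Sv <= Fv ->
  Rabs (Su - Sv) <= D -> Rabs (Fu - Fv) <= fu * D ->
  Rabs (Su / Fu - Sv / Fv) * Sv <= (/ fl + fu * (/ fl * / fl)) * D.
Proof.
  intros Hfl Hfu HS HFu HFv HD HFD.
  assert (Hi := Rinv_0_lt_compat _ Hfl).
  assert (HD0 : 0 <= D) by (generalize (Rabs_pos (Su - Sv)); lra).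
  destruct (Rle_lt_or_eq_dec 0 Sv (proj1 HS)) as [HSv|<-].
  2:{ rewrite Rmult_0_r. apply Rmult_le_pos; auto.
      apply Rplus_le_le_0_compat; [lra|]. apply Rmult_le_pos; auto.
      apply Rmult_le_pos; lra. }
  assert (H1 : 0 < fl * Sv) by (apply Rmult_lt_0_compat; auto).
  assert (H2 : fl * Sv <= fl * Su) by (apply Rmult_le_compat_l; lra).
  destruct (div_bound fl Sv Fu) as [Hp0 Hp]; try lra.
  destruct (div_bound fl Sv Fv) as [Hq0 Hq]; try lra.
  replace (Rabs (Su / Fu - Sv / Fv) * Sv) with (Rabs ((Su / Fu - Sv / Fv) * Sv))
    by (rewrite Rabs_mult, (Rabs_pos_eq Sv); lra).
  replace ((Su / Fu - Sv / Fv) * Sv)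
    with (Sv / Fu * (Su - Sv) + Sv / Fv * (Sv / Fu) * (Fv - Fu)) by (field; lra).
  apply Rle_trans with (1 := Rabs_triang _ _).
  rewrite !Rabs_mult, (Rabs_minus_sym Fv), !(Rabs_pos_eq (_ / _)) by auto.
  rewrite Rmult_plus_distr_r. apply Rplus_le_compat.
  - apply Rmult_le_compat; auto. apply Rabs_pos.
  - replace (fu * (/ fl * / fl) * D) with (/ fl * / fl * (fu * D)) by ring.
    apply Rmult_le_compat; auto.
    + apply Rmult_le_pos; auto.
    + apply Rabs_pos.
    + apply Rmult_le_compat; auto.
Qed.

Lemma inv_avg_bound w fl fu u :
  bounded_weight w fl fu -> l1_summable u -> (forall j, 0 <= u j) ->
  0 <= inv_avg w u <= / fl.
Proof.
  intros Hw Hu Hp. apply div_bound; [apply Hw | |].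
  - apply Series_nonneg; auto. apply l1_summable_ex_series, Hu.
  - apply weighted_Series_ge with fu; auto.
Qed.

(** One [/ fl] comes from the bound on [inv_avg], the remaining [/ fl + fu * (/ fl * / fl)] from
    [div_lipschitz]. *)
Definition avg_lip (fl fu : R) : R := 2 * / fl + fu * (/ fl * / fl).

Lemma l1_le_inv_avg w fl fu u v D :
  bounded_weight w fl fu -> l1_summable u -> l1_summable v ->
  (forall j, 0 <= u j) -> (forall j, 0 <= v j) ->
  l1_le (fun j => u j - v j) D ->
  l1_le (fun j => u j * inv_avg w u - v j * inv_avg w v) (avg_lip fl fu * D).
Proof.
  intros Hw.
  assert (Hfl : 0 < fl) by apply Hw.
  assert (Hfu : 0 <= fu) by (destruct Hw as [_ Hw]; generalize (Hw 0%nat); lra).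
  (* The splitting below multiplies the difference of the two [inv_avg] by [v], so [v] has to be the
     lighter family; the statement is symmetric up to sign. *)
  assert (Hwlog : forall u v, l1_summable u -> l1_summable v ->
    (forall j, 0 <= u j) -> (forall j, 0 <= v j) ->
    l1_le (fun j => u j - v j) D -> Series v <= Series u ->
    l1_le (fun j => u j * inv_avg w u - v j * inv_avg w v) (avg_lip fl fu * D)).
  { clear u v. intros u v Hu Hv Hpu Hpv HD Hle.
    destruct (inv_avg_bound w fl fu u Hw Hu Hpu) as [Ha0 Ha].
    pose proof (l1_summable_ex_series _ Hu) as Eu.
    pose proof (l1_summable_ex_series _ Hv) as Ev.
    assert (Hwu : forall u, l1_summable u -> ex_series (fun l => w l * u l)).
    { intros z Hz. apply l1_summable_ex_series, l1_summable_mult with fu; auto.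
      intros j. apply bounded_weight_abs with fl, Hw. }
    apply (l1_le_ext (fun j => inv_avg w u * (u j - v j) +
      (inv_avg w u - inv_avg w v) * v j)).
    { intros j. ring. }
    replace (avg_lip fl fu * D)
      with (/ fl * D + (/ fl + fu * (/ fl * / fl)) * D) by (unfold avg_lip; ring).
    apply l1_le_plus.
    - apply (l1_le_mult (fun _ => inv_avg w u)); auto.
      + generalize (Rinv_0_lt_compat _ Hfl); lra.
      + intros _. rewrite Rabs_pos_eq; auto.
    - apply l1_le_weaken with
        (Rabs (inv_avg w u - inv_avg w v) * Series (fun j => Rabs (v j))).
      + rewrite (Series_ext _ v) by (intros; apply Rabs_pos_eq, Hpv).
        apply div_lipschitz; auto.
        * split; auto. apply Series_nonneg; auto.
        * apply weighted_Series_ge with fu; auto.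
        * apply weighted_Series_ge with fu; auto.
        * rewrite <- Series_minus by auto. apply l1_le_Series, HD.
        * rewrite <- Series_minus by auto. apply l1_le_Series.
          apply (l1_le_ext (fun j => w j * (u j - v j))).
          { intros j. ring. }
          apply l1_le_mult; auto. intros j. apply bounded_weight_abs with fl, Hw.
      + apply (l1_le_mult (fun _ => inv_avg w u - inv_avg w v)).
        * apply Rabs_pos.
        * intros _. apply Rle_refl.
        * apply ex_series_l1_le. destruct Hv as [B HB].
          apply l1_le_ex_series with (1 := HB). }
  intros Hu Hv Hpu Hpv HD.
  destruct (Rle_dec (Series v) (Series u)) as [Hle|Hle]; [apply Hwlog; auto|].
  apply (l1_le_abs_le (fun j => v j * inv_avg w v - u j * inv_avg w u)).
  - intros j. rewrite Rabs_minus_sym. apply Rle_refl.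
  - apply Hwlog; auto; [|lra]. apply l1_le_abs_le with (2 := HD).
    intros j. rewrite Rabs_minus_sym. apply Rle_refl.
Qed.

(** The hypotheses in the form used by the estimates: constants common to all levels, and the time
    regularity of [lam] expressed by one-sided limits. *)
Record model (M : nat) (lam : R -> nat -> R) (f : R -> R)
  (mu : nat -> nat -> nat -> R) (fl fu C : R) : Prop := {
  model_lam_nonneg : forall t i, 0 <= t -> (i <= M)%nat -> 0 <= lam t i;
  model_lam_regulated : forall i, (i <= M)%nat -> regulated (fun s => lam s i);
  model_lam_bounded : forall T, 0 < T -> exists D, forall t i,
    0 <= t <= T -> (i <= M)%nat -> Rabs (lam t i) <= D;
  model_weight : bounded_weight (fun l => f (INR l)) fl fu;
  model_rates : forall i, (i <= M)%nat -> rate_matrix (mu i) C }.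

Definition level_nonneg (M : nat) (x : lfamily) : Prop :=
  forall i j, (i <= M)%nat -> 0 <= x i j.

(** The flux of mass leaving level [i] for level [i + 1], at position [j]. *)
Definition flow (lam : R -> nat -> R) (f : R -> R) (t : R) (x : lfamily) : lfamily :=
  fun i j => lam t i * ratio f x i j * f (INR j).

Lemma level_summable_seq M x i : level_summable M x -> (i <= M)%nat -> l1_summable (x i).
Proof. intros [B HB] Hi. exists B. apply HB, Hi. Qed.

Lemma avg_lip_nonneg w fl fu : bounded_weight w fl fu -> 0 <= avg_lip fl fu.
Proof.
  intros [Hfl Hw]. assert (Hi := Rinv_0_lt_compat _ Hfl).
  assert (Hfu : 0 <= fu) by (generalize (Hw 0%nat); lra).
  unfold avg_lip. apply Rplus_le_le_0_compat; [lra|].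
  apply Rmult_le_pos; auto. apply Rmult_le_pos; lra.
Qed.

Lemma flow_lipschitz M lam f mu fl fu C t x y i B D :
  model M lam f mu fl fu C -> (i <= M)%nat ->
  level_summable M x -> level_summable M y ->
  level_nonneg M x -> level_nonneg M y -> Rabs (lam t i) <= B ->
  level_le M (fam_minus x y) D ->
  l1_le (fun j => flow lam f t x i j - flow lam f t y i j)
    (B * fu * (avg_lip fl fu * D)).
Proof.
  intros Hm Hi Hx Hy Hpx Hpy HB HD.
  assert (Hw := model_weight _ _ _ _ _ _ _ Hm).
  apply (l1_le_ext (fun j => (lam t i * f (INR j)) *
    (x i j * inv_avg (fun l => f (INR l)) (x i) -
     y i j * inv_avg (fun l => f (INR l)) (y i)))).
  { intros j. unfold flow. rewrite !ratio_inv_avg. ring. }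
  assert (HfB : forall j, Rabs (lam t i * f (INR j)) <= B * fu).
  { intros j. rewrite Rabs_mult. apply Rmult_le_compat; auto using Rabs_pos.
    apply (bounded_weight_abs _ _ _ j Hw). }
  apply l1_le_mult; auto.
  - apply Rle_trans with (2 := HfB 0%nat), Rabs_pos.
  - apply l1_le_inv_avg; auto.
    + apply level_summable_seq with M; auto.
    + apply level_summable_seq with M; auto.
    + apply HD, Hi.
Qed.

Lemma Psi_lipschitz M lam f mu fl fu C T :
  model M lam f mu fl fu C -> 0 < T ->
  exists L, 0 <= L /\ forall t x y D, 0 <= t <= T ->
    level_summable M x -> level_summable M y ->
    level_nonneg M x -> level_nonneg M y ->
    level_le M (fam_minus x y) D ->
    level_le M (fam_minus (Psi M lam f mu t x) (Psi M lam f mu t y)) (L * D).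
Proof.
  intros Hm HT.
  destruct (model_lam_bounded _ _ _ _ _ _ _ Hm T HT) as [B HB].
  assert (HB0 : 0 <= B).
  { apply Rle_trans with (Rabs (lam 0 0%nat)); [apply Rabs_pos|].
    apply HB; [lra | lia]. }
  assert (Hfu : 0 <= fu).
  { destruct (model_weight _ _ _ _ _ _ _ Hm) as [Hfl Hw].
    generalize (Hw 0%nat). lra. }
  assert (Ha := avg_lip_nonneg _ _ _ (model_weight _ _ _ _ _ _ _ Hm)).
  assert (HC : 0 <= 2 * C).
  { apply (l1_le_nonneg (mu 0%nat 0%nat)), rate_matrix_row.
    apply (model_rates _ _ _ _ _ _ _ Hm); lia. }
  set (K := B * fu * avg_lip fl fu).
  assert (HK : 0 <= K) by (repeat apply Rmult_le_pos; auto).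
  (* The rate matrix contributes [2 * C], the incoming and the outgoing flux one [K] each. *)
  exists (2 * C + K + K). split; [lra|].
  intros t x y D Ht Hx Hy Hpx Hpy HD i Hi.
  assert (HKD : 0 <= K * D).
  { apply Rmult_le_pos; auto. apply (level_le_nonneg _ _ _ HD). }
  assert (Hflow : forall k, (k <= M)%nat ->
    l1_le (fun j => flow lam f t x k j - flow lam f t y k j) (K * D)).
  { intros k Hk. unfold K. rewrite Rmult_assoc.
    apply flow_lipschitz with (1 := Hm); auto. }
  assert (Hzero : l1_le (fun _ => 0) (K * D)).
  { intros N. rewrite sum_eq_R0; auto. intros; apply Rabs_R0. }
  apply (l1_le_ext (fun j =>
    (rate_image (mu i) (fam_minus x y i) j +
     (if (1 <=? i)%nat then flow lam f t x (i - 1)%nat j - flow lam f t y (i - 1)%nat j else 0)) -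
     (if (i <=? M - 1)%nat then flow lam f t x i j - flow lam f t y i j else 0))).
  { intros j. unfold fam_minus at 1. rewrite rate_image_minus with (C := C).
    - unfold fam_minus, Psi, flow, rate_image.
      destruct (1 <=? i)%nat, (i <=? M - 1)%nat; ring.
    - apply (model_rates _ _ _ _ _ _ _ Hm), Hi.
    - apply level_summable_seq with M; auto.
    - apply level_summable_seq with M; auto. }
  rewrite !Rmult_plus_distr_r. apply l1_le_minus; [apply l1_le_plus|].
  - apply l1_le_rate_image; [|apply HD, Hi].
    apply (model_rates _ _ _ _ _ _ _ Hm), Hi.
  - destruct (1 <=? i)%nat; [apply Hflow; lia | auto].
  - destruct (i <=? M - 1)%nat; [apply Hflow; lia | auto].
Qed.

Lemma Psi_ext M lam f mu t x y i j :
  (i <= M)%nat -> (forall k l, (k <= M)%nat -> x k l = y k l) ->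
  Psi M lam f mu t x i j = Psi M lam f mu t y i j.
Proof.
  intros Hi Hxy.
  assert (Hr : forall k, (k <= M)%nat -> ratio f x k j = ratio f y k j).
  { intros k Hk. rewrite !ratio_inv_avg. unfold inv_avg.
    rewrite Hxy, (Series_ext (x k) (y k)) by auto.
    rewrite (Series_ext (fun l => f (INR l) * x k l) (fun l => f (INR l) * y k l)); auto.
    intros l. now rewrite Hxy. }
  unfold Psi. rewrite (Hr i Hi), (Hr (i - 1)%nat) by lia.
  f_equal. f_equal. apply Series_ext. intros k. now rewrite Hxy.
Qed.

(** The field points inwards on the boundary of the nonnegative cone. A vanishing component kills
    the only negative contributions, the diagonal rate and the outgoing flux; off-diagonal rates and
    incoming flux remain. *)
Lemma Psi_nonneg M lam f mu fl fu C t x i j :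
  model M lam f mu fl fu C -> 0 <= t -> (i <= M)%nat ->
  level_summable M x -> level_nonneg M x -> x i j = 0 ->
  0 <= Psi M lam f mu t x i j.
Proof.
  intros Hm Ht Hi Hx Hp H0.
  assert (Hw := model_weight _ _ _ _ _ _ _ Hm).
  assert (Hmu := model_rates _ _ _ _ _ _ _ Hm i Hi).
  unfold Psi. rewrite (ratio_inv_avg f x i j), H0.
  assert (H1 : 0 <= Series (fun k => mu i k j * x i k)).
  { apply Series_nonneg.
    - apply l1_summable_ex_series, rate_image_summable with C; auto.
      apply level_summable_seq with M; auto.
    - intros k. destruct (Nat.eq_dec k j) as [->|Hk].
      + rewrite H0. lra.
      + apply Rmult_le_pos; auto. apply Hmu, Hk. }
  assert (H2 : 0 <= if (1 <=? i)%nat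
    then lam t (i - 1)%nat * ratio f x (i - 1)%nat j * f (INR j) else 0).
  { destruct (1 <=? i)%nat; [|lra]. rewrite ratio_inv_avg.
    apply Rmult_le_pos; [apply Rmult_le_pos; [|apply Rmult_le_pos]|].
    - apply (model_lam_nonneg _ _ _ _ _ _ _ Hm); auto. lia.
    - apply Hp. lia.
    - apply (inv_avg_bound _ fl fu); auto.
      + apply level_summable_seq with M; auto. lia.
      + intros k. apply Hp. lia.
    - destruct Hw as [Hfl Hw]. generalize (Hw j). lra. }
  destruct (i <=? M - 1)%nat; lra.
Qed.

(** * The field composed with the positive part *)

Definition pos_part (x : lfamily) : lfamily := fun i j => Rmax 0 (x i j).

Lemma level_nonneg_pos_part M x : level_nonneg M (pos_part x).
Proof. intros i j _. apply Rmax_l. Qed.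

Lemma level_le_pos_part M x y B :
  level_le M (fam_minus x y) B -> level_le M (fam_minus (pos_part x) (pos_part y)) B.
Proof.
  intros H i Hi. apply l1_le_abs_le with (2 := H i Hi).
  intros j. unfold fam_minus, pos_part.
  apply Rmax_case_strong; apply Rmax_case_strong; intros; unfold Rabs;
    repeat destruct Rcase_abs; lra.
Qed.

Lemma level_summable_pos_part M x : level_summable M x -> level_summable M (pos_part x).
Proof.
  intros [B HB]. exists B. intros i Hi. apply l1_le_abs_le with (2 := HB i Hi).
  intros j. unfold pos_part. apply Rmax_case_strong; intros; unfold Rabs;
    repeat destruct Rcase_abs; lra.
Qed.

Definition pos_field (M : nat) (lam : R -> nat -> R) (f : R -> R)
  (mu : nat -> nat -> nat -> R) : R -> lfamily -> lfamily :=
  fun t x => Psi M lam f mu t (pos_part x).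

Lemma pos_field_lipschitz M lam f mu fl fu C :
  model M lam f mu fl fu C -> lipschitz_field M (pos_field M lam f mu).
Proof.
  intros Hm. split.
  - intros T HT. destruct (Psi_lipschitz _ _ _ _ _ _ _ T Hm HT) as [L [HL0 HL]].
    exists L. split; auto. intros t x y B Ht Hx Hy HB.
    apply HL; auto using level_summable_pos_part, level_nonneg_pos_part,
      level_le_pos_part.
  - intros t i j Hi. unfold pos_field, pos_part. rewrite (Rmax_left 0 0) by lra.
    unfold Psi. rewrite !ratio_inv_avg.
    rewrite (is_series_unique (fun k => mu i k j * 0) 0).
    + destruct (1 <=? i)%nat, (i <=? M - 1)%nat; ring.
    + apply is_series_ext with (fun k => if Nat.eqb k 0 then 0 else 0).
      * intros k. rewrite Rmult_0_r. now destruct (Nat.eqb k 0).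
      * apply is_series_single.
Qed.

(** Along a Lipschitz path the rate and ratio terms are Lipschitz in time, being Lipschitz in the
    state; jumps in time enter only through the factor [lam]. *)
Lemma pos_field_regulated M lam f mu fl fu C x i j :
  model M lam f mu fl fu C -> lipschitz_path M x -> (i <= M)%nat ->
  regulated (fun s => pos_field M lam f mu s (x s) i j).
Proof.
  intros Hm Hx Hi.
  assert (Hw := model_weight _ _ _ _ _ _ _ Hm).
  assert (Hpos : forall s k, 0 <= s -> (k <= M)%nat -> l1_summable (pos_part (x s) k)).
  { intros s k Hs Hk. apply level_summable_seq with M; auto.
    apply level_summable_pos_part, lipschitz_path_summable; auto. }
  assert (Hrate : regulated (fun s => rate_image (mu i) (pos_part (x s) i) j)).
  { apply regulated_lipschitz. intros T HT. destruct (Hx T HT) as [K [HK _]].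
    exists (2 * C * K). intros s t Hst HtT.
    assert (Hmu := model_rates _ _ _ _ _ _ _ Hm i Hi).
    rewrite <- rate_image_minus with (C := C); auto; [| apply Hpos; auto; lra ..].
    rewrite Rmult_assoc. apply l1_le_comp, l1_le_rate_image; auto.
    apply (level_le_pos_part M (x t) (x s)); auto. }
  assert (Hflow : forall k, (k <= M)%nat ->
    regulated (fun s => lam s k * ratio f (pos_part (x s)) k j * f (INR j))).
  { intros k Hk. apply regulated_mult; [apply regulated_mult|apply regulated_const].
    - apply (model_lam_regulated _ _ _ _ _ _ _ Hm), Hk.
    - apply regulated_lipschitz. intros T HT. destruct (Hx T HT) as [K [HK _]].
      exists (avg_lip fl fu * K). intros s t Hst HtT. rewrite !ratio_inv_avg.
      rewrite Rmult_assoc.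
      apply (l1_le_comp (fun j =>
        pos_part (x t) k j * inv_avg (fun l => f (INR l)) (pos_part (x t) k) -
        pos_part (x s) k j * inv_avg (fun l => f (INR l)) (pos_part (x s) k))).
      apply l1_le_inv_avg; auto.
      + apply Hpos; auto; lra.
      + apply Hpos; auto; lra.
      + intros l. apply Rmax_l.
      + intros l. apply Rmax_l.
      + apply (level_le_pos_part M (x t) (x s)); auto. }
  unfold pos_field, Psi. apply regulated_minus; [apply regulated_plus|].
  - exact Hrate.
  - destruct (1 <=? i)%nat; [apply Hflow; lia | apply regulated_const].
  - destruct (i <=? M - 1)%nat; [apply Hflow; lia | apply regulated_const].
Qed.

Lemma pos_field_integrable M lam f mu fl fu C :
  model M lam f mu fl fu C -> integrable_field M (pos_field M lam f mu).
Proof.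
  intros Hm x Hx i j t Hi Ht. apply regulated_ex_RInt; [|lra].
  apply pos_field_regulated with fl fu C; auto.
Qed.

(** * Positivity and conservation of mass *)

(** If [p t] were negative, let [c] be the last time before [t] at which [p] is nonnegative. Then
    [p] is negative between [c] and [t], so [g] is nonnegative there and [p] cannot have
    decreased. *)
Lemma nonneg_of_integral (p g : R -> R) :
  locally_lipschitz p -> 0 <= p 0 ->
  (forall s t, 0 <= s <= t -> is_RInt g s t (p t - p s)) ->
  (forall s, 0 <= s -> p s < 0 -> 0 <= g s) ->
  forall t, 0 <= t -> 0 <= p t.
Proof.
  intros Hlip H0 Hint Hg t Ht.
  destruct (Rle_dec 0 (p t)) as [|Hneg]; auto.
  destruct (completeness (fun s => 0 <= s <= t /\ 0 <= p s)) as [c [Hub Hlub]].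
  { exists t. intros s Hs. lra. }
  { exists 0. lra. }
  assert (Hc0 : 0 <= c) by (apply Hub; lra).
  assert (Hct : c <= t) by (apply Hlub; intros s Hs; lra).
  assert (Hpc : 0 <= p c).
  { destruct (Rle_dec 0 (p c)) as [|Hpc]; auto. exfalso.
    destruct (Hlip (t + 1)) as [K HK]; [lra|].
    set (K' := Rabs K + 1).
    assert (HK' : 0 < K') by (unfold K'; generalize (Rabs_pos K); lra).
    (* With slope at most [K'], a negative [p c] forces [p] to be negative over this length before
       [c], so [c] would not be the least upper bound. *)
    assert (Hd : 0 < - p c / K') by (apply Rdiv_lt_0_compat; lra).
    assert (Hle : c <= c - - p c / K').
    { apply Hlub. intros s [Hs Hps].
      assert (Hsc : s <= c) by (apply Hub; lra).
      destruct (Rle_dec s (c - - p c / K')) as [|Hsd]; auto. exfalso.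
      assert (H1 : Rabs (p c - p s) <= K * (c - s)) by (apply HK; lra).
      assert (H2 : K * (c - s) <= K' * (c - s)).
      { apply Rmult_le_compat_r; [lra|]. unfold K'. generalize (Rle_abs K). lra. }
      assert (H3 : K' * (c - s) < K' * (- p c / K')) by (apply Rmult_lt_compat_l; lra).
      replace (K' * (- p c / K')) with (- p c) in H3 by (field; lra).
      rewrite Rabs_left in H1; lra. }
    lra. }
  assert (Hle : 0 <= p t - p c); [|lra].
  apply (is_RInt_le (fun _ => 0) g c t); auto.
  - pose proof (is_RInt_const c t 0) as Hz.
    change (is_RInt (fun _ => 0) c t ((t - c) * 0)) in Hz.
    now rewrite Rmult_0_r in Hz.
  - intros s Hs. apply Hg; [lra|].
    destruct (Rlt_dec (p s) 0) as [|Hps]; auto. exfalso.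
    assert (s <= c) by (apply Hub; lra). lra.
Qed.

Lemma lipschitz_path_component M x i j :
  lipschitz_path M x -> (i <= M)%nat -> locally_lipschitz (fun s => x s i j).
Proof.
  intros Hx Hi T HT. destruct (Hx T HT) as [K [HK _]]. exists K.
  intros s t Hst HtT. apply (l1_le_comp (fam_minus (x t) (x s) i)), HK; auto.
Qed.

Lemma pos_field_solution_nonneg M lam f mu fl fu C u0 P :
  model M lam f mu fl fu C -> level_nonneg M u0 ->
  lipschitz_path M P -> integrates M (pos_field M lam f mu) u0 P P ->
  forall t, 0 <= t -> level_nonneg M (P t).
Proof.
  intros Hm Hu0 Hlip HP t Ht i j Hi.
  apply (nonneg_of_integral (fun s => P s i j)
    (fun s => pos_field M lam f mu s (P s) i j)); auto.
  - apply lipschitz_path_component with M; auto.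
  - rewrite (integrates_initial _ _ _ _ _ _ _ HP Hi). apply Hu0, Hi.
  - intros r s Hrs. apply integrates_increment with (1 := HP); auto.
  (* A negative component has zero positive part, which is the vanishing component required by
     [Psi_nonneg]. *)
  - intros s Hs Hneg. apply Psi_nonneg with (1 := Hm); auto.
    + apply level_summable_pos_part, lipschitz_path_summable; auto.
    + apply level_nonneg_pos_part.
    + unfold pos_part. apply Rmax_left. lra.
Qed.

Lemma ex_series_flow M lam f mu fl fu C t x i :
  model M lam f mu fl fu C -> (i <= M)%nat ->
  level_summable M x ->
  forall lam', ex_series (flow lam' f t x i).
Proof.
  intros Hm Hi Hx lam'. apply l1_summable_ex_series.
  assert (Hw := model_weight _ _ _ _ _ _ _ Hm).
  destruct (level_summable_seq _ _ _ Hx Hi) as [B HB].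
  set (c := Rabs (lam' t i * inv_avg (fun l => f (INR l)) (x i))).
  exists (c * fu * B).
  apply (l1_le_ext (fun j =>
    (lam' t i * inv_avg (fun l => f (INR l)) (x i) * f (INR j)) * x i j)).
  { intros j. unfold flow. rewrite ratio_inv_avg. ring. }
  apply l1_le_mult; auto.
  - apply Rmult_le_pos; [apply Rabs_pos|]. destruct Hw as [Hfl Hw].
    generalize (Hw 0%nat). lra.
  - intros j. rewrite Rabs_mult. apply Rmult_le_compat_l; [apply Rabs_pos|].
    apply (bounded_weight_abs _ _ _ j Hw).
Qed.

(* [lam'] is arbitrary: it is applied to the time averages of [lam]. *)
Lemma Psi_mass M lam f mu fl fu C lam' t x :
  (1 <= M)%nat -> model M lam f mu fl fu C -> level_summable M x ->
  exists l, (forall i, (i <= M)%nat -> is_series (Psi M lam' f mu t x i) (l i)) /\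
    sum_f_R0 l M = 0.
Proof.
  intros HM Hm Hx.
  set (inflow := fun i => if (1 <=? i)%nat then Series (flow lam' f t x (i - 1)%nat) else 0).
  set (outflow := fun i => if (i <=? M - 1)%nat then Series (flow lam' f t x i) else 0).
  assert (Hzero : is_series (fun _ : nat => 0) 0).
  { apply is_series_ext with (fun k => if Nat.eqb k 0 then 0 else 0).
    - intros k. destruct (Nat.eqb k 0); reflexivity.
    - apply is_series_single. }
  assert (Hflow : forall i, (i <= M)%nat ->
    is_series (flow lam' f t x i) (Series (flow lam' f t x i))).
  { intros i Hi. apply Series_correct.
    apply ex_series_flow with (1 := Hm); auto. }
  exists (fun i => 0 + inflow i - outflow i). split.
  - intros i Hi.
    apply (is_series_minus (fun j => rate_image (mu i) (x i) j +
        (if (1 <=? i)%nat then flow lam' f t x (i - 1)%nat j else 0))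
      (fun j => if (i <=? M - 1)%nat then flow lam' f t x i j else 0)
      (0 + inflow i) (outflow i)).
    + apply (is_series_plus (rate_image (mu i) (x i))
        (fun j => if (1 <=? i)%nat then flow lam' f t x (i - 1)%nat j else 0) 0 (inflow i)).
      * apply is_series_rate_image with C.
        -- apply (model_rates _ _ _ _ _ _ _ Hm), Hi.
        -- apply level_summable_seq with M; auto.
      * unfold inflow. destruct (1 <=? i)%nat; auto. apply Hflow. lia.
    + unfold outflow. destruct (i <=? M - 1)%nat; auto.
  (* What enters level [n + 1] is what leaves level [n], so after level [n] only its outgoing flux
     is left. *)
  - assert (Htel : forall n, (n <= M)%nat ->
      sum_f_R0 (fun i => 0 + inflow i - outflow i) n = - outflow n).
    { induction n as [|n IH]; intros Hn.
      - unfold sum_f_R0, inflow. simpl (1 <=? 0)%nat. cbv iota. ring.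
      - rewrite tech5, IH by lia.
        replace (inflow (S n)) with (outflow n); [ring|].
        unfold inflow, outflow.
        rewrite (proj2 (Nat.leb_le n (M - 1))) by lia.
        rewrite (proj2 (Nat.leb_le 1 (S n))) by lia.
        do 2 f_equal. lia. }
    (* Nothing leaves the top level, since [M <= M - 1] fails; with truncated subtraction this
       relies on [1 <= M]. *)
    rewrite Htel by lia. unfold outflow.
    rewrite (proj2 (Nat.leb_gt M (M - 1))) by lia. ring.
Qed.

(** Cutting [[0, T]] into [S n] equal pieces of length [d] bounds the total increment by
    [INR (S n) * (c * d ^ 2)], of order [1 / INR (S n)]. Multiplied by [INR (S n)], it stays below
    [c * T ^ 2] for every [n], so it must vanish. *)
Lemma quadratic_increments_constant (m : R -> R) c T :
  0 < T ->
  (forall s t, 0 <= s < t -> t <= T -> Rabs (m t - m s) <= c * (t - s) ^ 2) ->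
  m T = m 0.
Proof.
  intros HT Hq.
  assert (Hn : forall n, Rabs (m T - m 0) * INR (S n) <= c * T ^ 2).
  { intros n. assert (Hpos : 0 < INR (S n)) by (apply lt_0_INR; lia).
    set (d := T / INR (S n)).
    assert (Hd : 0 < d) by (apply Rdiv_lt_0_compat; auto).
    assert (Hnd : INR (S n) * d = T) by (unfold d; field; lra).
    assert (Hk : forall k, (k <= S n)%nat ->
      Rabs (m (INR k * d) - m 0) <= INR k * (c * d ^ 2)).
    { induction k as [|k IH]; intros Hk.
      - simpl. rewrite !Rmult_0_l, Rminus_diag, Rabs_R0. lra.
      - replace (m (INR (S k) * d) - m 0)
          with ((m (INR (S k) * d) - m (INR k * d)) + (m (INR k * d) - m 0)) by ring.
        apply Rle_trans with (1 := Rabs_triang _ _).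
        assert (Hk1 : INR (S k) * d <= T).
        { rewrite <- Hnd. apply Rmult_le_compat_r; [lra|]. apply le_INR, Hk. }
        assert (Hk0 : 0 <= INR k * d) by (apply Rmult_le_pos; [apply pos_INR | lra]).
        specialize (IH ltac:(lia)).
        assert (H1 : Rabs (m (INR (S k) * d) - m (INR k * d)) <= c * d ^ 2).
        { replace (d ^ 2) with ((INR (S k) * d - INR k * d) ^ 2)
            by (rewrite S_INR; ring).
          rewrite S_INR in *. apply Hq; lra. }
        rewrite S_INR in *. lra. }
    specialize (Hk (S n) (le_n _)). rewrite Hnd in Hk.
    apply Rle_trans with (INR (S n) * (c * d ^ 2) * INR (S n)).
    - apply Rmult_le_compat_r; lra.
    - right. unfold d. field. lra. }
  destruct (Req_dec (m T - m 0) 0) as [|Hne]; [lra|]. exfalso.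
  apply Rabs_pos_lt in Hne.
  destruct (INR_unbounded (c * T ^ 2 / Rabs (m T - m 0))) as [n Hlt].
  apply Rlt_div_l in Hlt; auto.
  specialize (Hn n). rewrite S_INR in Hn. lra.
Qed.

(** For a frozen family [x], [Psi] is affine in the intensities, so integrating in time replaces
    them by their means. The averaged intensity does not depend on time, and the argument 0 is a
    placeholder. *)
Lemma Psi_time_average M lam f mu fl fu C s t x i j :
  model M lam f mu fl fu C -> 0 <= s < t -> (i <= M)%nat ->
  is_RInt (fun r => Psi M lam f mu r x i j) s t
    ((t - s) * Psi M (fun _ k => RInt (fun r => lam r k) s t / (t - s)) f mu 0 x i j).
Proof.
  intros Hm Hst Hi.
  assert (Hflow : forall k, (k <= M)%nat ->
    is_RInt (fun r => lam r k * ratio f x k j * f (INR j)) s t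
      ((t - s) * (RInt (fun r => lam r k) s t / (t - s) * ratio f x k j * f (INR j)))).
  { intros k Hk.
    apply is_RInt_ext with (fun r => (ratio f x k j * f (INR j)) * lam r k).
    { intros r _. rewrite Rmult_comm. symmetry. apply Rmult_assoc. }
    replace ((t - s) * (RInt (fun r => lam r k) s t / (t - s) * ratio f x k j * f (INR j)))
      with ((ratio f x k j * f (INR j)) * RInt (fun r => lam r k) s t)
      by (set (r := RInt _ s t : R); change (RInt _ s t) with r; field; lra).
    apply (is_RInt_scal (fun r => lam r k)), (RInt_correct (fun r => lam r k)).
    apply regulated_ex_RInt; [|lra].
    apply (model_lam_regulated _ _ _ _ _ _ _ Hm), Hk. }
  assert (Hzero : is_RInt (fun _ => 0) s t ((t - s) * 0))
    by apply (is_RInt_const s t 0).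
  unfold Psi. rewrite Rmult_minus_distr_l, Rmult_plus_distr_l.
  apply (is_RInt_minus (fun r => Series (fun k => mu i k j * x i k) +
    (if (1 <=? i)%nat then lam r (i - 1)%nat * ratio f x (i - 1)%nat j * f (INR j) else 0))).
  - apply (is_RInt_plus (fun _ => Series (fun k => mu i k j * x i k))).
    + apply (is_RInt_const s t (Series (fun k => mu i k j * x i k))).
    + destruct (1 <=? i)%nat; auto. apply Hflow. lia.
  - destruct (i <=? M - 1)%nat; auto.
Qed.

(* Freezing [P] at time [s] in [Psi] makes the increment of mass over [[s, t]]
   vanish, at the price of an error quadratic in [t - s]; this avoids
   exchanging the sum over [j] with the time integral. *)
Lemma mass_conserved M lam f mu fl fu C u0 P T :
  (1 <= M)%nat -> model M lam f mu fl fu C -> lipschitz_path M P ->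
  (forall t, 0 <= t -> level_nonneg M (P t)) ->
  integrates M (Psi M lam f mu) u0 P P -> 0 < T ->
  sum_f_R0 (fun i => Series (P T i)) M = sum_f_R0 (fun i => Series (P 0 i)) M.
Proof.
  intros HM Hm Hlip Hpos HP HT.
  destruct (Hlip T HT) as [K [HK _]].
  destruct (Psi_lipschitz _ _ _ _ _ _ _ T Hm HT) as [L [HL0 HL]].
  assert (HK0 : 0 <= K).
  { assert (H : 0 <= K * (T - 0)).
    { apply level_le_nonneg with (1 := HK 0 T ltac:(lra) ltac:(lra)). }
    apply Rmult_le_reg_r with T; lra. }
  (* Each of the [S M] levels contributes an error of at most [L * K * (t - s) ^ 2]. *)
  apply (quadratic_increments_constant (fun t => sum_f_R0 (fun i => Series (P t i)) M)
    (L * K * INR (S M))); auto.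
  intros s t Hst HtT.
  assert (Hsum : forall r, 0 <= r -> level_summable M (P r))
    by (intros; apply lipschitz_path_summable; auto).
  set (lam' := fun (_ : R) k => RInt (fun r => lam r k) s t / (t - s)).
  destruct (Psi_mass _ _ _ _ _ _ _ lam' 0 (P s) HM Hm (Hsum s ltac:(lra)))
    as [l [Hl Hl0]].
  set (err := fun i j => P t i j - P s i j - (t - s) * Psi M lam' f mu 0 (P s) i j).
  assert (Herr : forall i, (i <= M)%nat -> l1_le (err i) (L * K * (t - s) ^ 2)).
  { intros i Hi. apply (l1_le_RInt
      (fun r => fam_minus (Psi M lam f mu r (P r)) (Psi M lam f mu r (P s)) i)
      (fun _ => L * (K * (t - s))) _ _ s t); [lra | | |].
    - intros j.
      apply (is_RInt_minus (fun r => Psi M lam f mu r (P r) i j)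
        (fun r => Psi M lam f mu r (P s) i j)).
      + apply integrates_increment with (1 := HP); auto; lra.
      + apply Psi_time_average with fl fu C; auto; lra.
    - replace (L * K * (t - s) ^ 2) with ((t - s) * (L * (K * (t - s)))) by ring.
      apply (is_RInt_const s t (L * (K * (t - s)))).
    - intros r Hr. apply HL; auto; try apply Hsum; try apply Hpos; try lra.
      apply level_le_weaken with (K * (r - s)).
      + apply Rmult_le_compat_l; lra.
      + apply HK; lra. }
  assert (Hdiff : forall i, (i <= M)%nat ->
    Series (P t i) - Series (P s i) = Series (err i) + l i * (t - s)).
  { intros i Hi.
    assert (Ht := l1_summable_ex_series _ (level_summable_seq _ _ _ (Hsum t ltac:(lra)) Hi)).
    assert (Hs := l1_summable_ex_series _ (level_summable_seq _ _ _ (Hsum s ltac:(lra)) Hi)).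
    rewrite <- Series_minus by auto.
    rewrite (Series_ext _ (fun j => err i j + (t - s) * Psi M lam' f mu 0 (P s) i j))
      by (intros; unfold err; ring).
    rewrite Series_plus, Series_scal_l.
    - rewrite (is_series_unique _ _ (Hl i Hi)). ring.
    - apply l1_summable_ex_series. eexists. apply Herr, Hi.
    - apply (ex_series_scal (t - s) (fun j => Psi M lam' f mu 0 (P s) i j)).
      eexists. apply Hl, Hi. }
  rewrite <- minus_sum.
  rewrite (sum_eq _ (fun i => Series (err i) + l i * (t - s))) by auto.
  rewrite plus_sum, <- scal_sum, Hl0, Rmult_0_r, Rplus_0_r.
  apply Rle_trans with (1 := Rsum_abs _ _).
  apply Rle_trans with (sum_f_R0 (fun _ => L * K * (t - s) ^ 2) M).
  - apply sum_Rle. intros i Hi. apply l1_le_Series, Herr, Hi.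
  - rewrite sum_cte. right. ring.
Qed.

(** * Existence and uniqueness *)

Lemma P0_nonneg M x0 y0 : level_nonneg M (P0 x0 y0).
Proof. intros i j _. unfold P0. destruct (_ && _)%bool; lra. Qed.

Lemma is_series_P0 x0 y0 i :
  is_series (P0 x0 y0 i) (if Nat.eqb i x0 then 1 else 0).
Proof.
  apply is_series_ext with
    (fun j => if Nat.eqb j y0 then (if Nat.eqb i x0 then 1 else 0) else 0).
  - intros j. unfold P0. destruct (Nat.eqb i x0), (Nat.eqb j y0); reflexivity.
  - apply is_series_single.
Qed.

Lemma sum_f_R0_single c k n :
  (k <= n)%nat -> sum_f_R0 (fun i => if Nat.eqb i k then c else 0) n = c.
Proof.
  intros Hk. induction Hk as [|n Hk IH].
  - destruct k as [|k]; [reflexivity|]. rewrite tech5, Nat.eqb_refl, sum_eq_R0; [ring|].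
    intros i Hi. destruct (Nat.eqb_spec i (S k)); [lia | reflexivity].
  - rewrite tech5, IH. destruct (Nat.eqb_spec (S n) k); [lia | ring].
Qed.

Lemma P0_summable M x0 y0 : level_summable M (P0 x0 y0).
Proof.
  exists 1. intros i Hi.
  apply l1_le_weaken with (Series (fun j => Rabs (P0 x0 y0 i j))).
  - rewrite (Series_ext _ (P0 x0 y0 i))
      by (intros; apply Rabs_pos_eq, (P0_nonneg i); auto).
    rewrite (is_series_unique _ _ (is_series_P0 x0 y0 i)).
    destruct (Nat.eqb i x0); lra.
  - apply ex_series_l1_le.
    apply ex_series_ext with (P0 x0 y0 i).
    + intros j. symmetry. apply Rabs_pos_eq, (P0_nonneg i); auto.
    + eexists. apply is_series_P0.
Qed.

Lemma sum_f_R0_term_le (a : nat -> R) k n :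
  (forall i, (i <= n)%nat -> 0 <= a i) -> (k <= n)%nat -> a k <= sum_f_R0 a n.
Proof.
  intros Ha Hk. apply Rle_trans with (sum_f_R0 (fun i => if Nat.eqb i k then a k else 0) n).
  - rewrite sum_f_R0_single by auto. apply Rle_refl.
  - apply sum_Rle. intros i Hi. destruct (Nat.eqb_spec i k) as [->|]; [lra|auto].
Qed.

(** Passage from the norm of the theorem, a sum over levels, to the level-wise bounds of the
    estimates. *)
Lemma level_le_fam_norm M u : fam_summable M u -> level_le M u (fam_norm M u).
Proof.
  intros Hu i Hi. apply l1_le_weaken with (Series (fun j => Rabs (u i j))).
  - apply (sum_f_R0_term_le (fun i => Series (fun j => Rabs (u i j)))); auto.
    intros k Hk. apply Series_nonneg; [apply Hu, Hk | intros; apply Rabs_pos].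
  - apply ex_series_l1_le, Hu, Hi.
Qed.

Lemma model_existence M lam f mu fl fu C x0 y0 :
  (1 <= M)%nat -> (x0 <= M)%nat -> model M lam f mu fl fu C ->
  exists P, is_solution M lam f mu x0 y0 P /\ is_prob_path M P.
Proof.
  intros HM Hx0 Hm.
  destruct (integral_solution_exists M (pos_field M lam f mu) (P0 x0 y0))
    as [P [Hlip HP]].
  - apply pos_field_lipschitz with fl fu C, Hm.
  - apply pos_field_integrable with fl fu C, Hm.
  - apply P0_summable.
  - assert (Hpos := pos_field_solution_nonneg _ _ _ _ _ _ _ _ _ Hm
      (P0_nonneg M x0 y0) Hlip HP).
    (* Nonnegativity makes the positive part act as the identity on the levels up to [M], so both
       fields have the same integrand. *)
    assert (Hsol : integrates M (Psi M lam f mu) (P0 x0 y0) P P).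
    { intros t i j Ht Hi.
      apply is_RInt_ext with (fun s => pos_field M lam f mu s (P s) i j).
      - intros s Hs. rewrite Rmin_left, Rmax_right in Hs by lra.
        apply Psi_ext; auto. intros k l Hk. apply Rmax_right, Hpos; auto; lra.
      - apply HP; auto. }
    assert (Habs : forall t i, 0 <= t -> (i <= M)%nat ->
      forall j, Rabs (P t i j) = P t i j).
    { intros t i Ht Hi j. apply Rabs_pos_eq, Hpos; auto. }
    assert (Hmass : forall t, 0 <= t -> sum_f_R0 (fun i => Series (P t i)) M = 1).
    { intros t Ht. transitivity (sum_f_R0 (fun i => Series (P 0 i)) M).
      - destruct (Rle_lt_or_eq_dec 0 t Ht) as [Hlt|<-]; auto.
        apply mass_conserved with (2 := Hm) (5 := Hsol); auto.
      - rewrite <- (sum_f_R0_single 1 x0 M Hx0). apply sum_eq. intros i Hi.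
        rewrite (Series_ext _ (P0 x0 y0 i)).
        + apply is_series_unique, is_series_P0.
        + intros j. apply (integrates_initial _ _ _ _ _ _ _ HP Hi). }
    exists P. split; [intros t Ht i j Hi; apply Hsol; auto|].
    intros t Ht. split; [|split].
    + apply Hpos, Ht.
    + intros i Hi. destruct (lipschitz_path_summable _ _ _ Hlip Ht) as [B HB].
      apply l1_le_ex_series with (1 := HB i Hi).
    + rewrite <- (Hmass t Ht). apply sum_eq. intros i Hi.
      apply Series_ext, Habs; auto.
Qed.

(** Two families of total mass 1 differ by at most [1 + 1] on every level, uniformly in time. This
    starts the contraction, so no continuity of [P] and [Q] has to be established. *)
Lemma model_uniqueness M lam f mu fl fu C x0 y0 P Q t i j :
  model M lam f mu fl fu C ->
  is_solution M lam f mu x0 y0 P -> is_prob_path M P ->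
  is_solution M lam f mu x0 y0 Q -> is_prob_path M Q ->
  0 <= t -> (i <= M)%nat -> P t i j = Q t i j.
Proof.
  intros Hm HP HPp HQ HQp Ht Hi.
  destruct (Psi_lipschitz _ _ _ _ _ _ _ (t + 1) Hm) as [L [HL0 HL]]; [lra|].
  assert (Hb : forall X, is_prob_path M X -> forall s, 0 <= s -> level_le M (X s) 1).
  { intros X HX s Hs. destruct (HX s Hs) as [_ [Hsum <-]].
    apply level_le_fam_norm, Hsum. }
  assert (Hsum : forall X, is_prob_path M X -> forall s, 0 <= s -> level_summable M (X s)).
  { intros X HX s Hs. exists 1. apply Hb; auto. }
  apply (integral_solution_unique M (Psi M lam f mu) (P0 x0 y0) P Q L (t + 1) (1 + 1));
    auto; try lra.
  - intros s k l Hs Hk. apply HP; auto.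
  - intros s k l Hs Hk. apply HQ; auto.
  - intros s B Hs HB. apply HL; auto.
    + apply Hsum; auto; lra.
    + apply Hsum; auto; lra.
    + exact (proj1 (HPp s (proj1 Hs))).
    + exact (proj1 (HQp s (proj1 Hs))).
  - intros s Hs k Hk. apply (l1_le_minus (P s k) (Q s k)); apply Hb; auto; lra.
Qed.

Lemma uniform_bound (a : nat -> nat -> R) M :
  (forall k, (k <= M)%nat -> exists C, forall i, a k i <= C) ->
  exists C, forall k i, (k <= M)%nat -> a k i <= C.
Proof.
  induction M as [|M IH]; intros H.
  - destruct (H 0%nat (le_n _)) as [C HC]. exists C. intros k i Hk.
    replace k with 0%nat by lia. apply HC.
  - destruct IH as [C HC]; [intros; apply H; lia|].
    destruct (H (S M) (le_n _)) as [D HD]. exists (Rmax C D). intros k i Hk.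
    destruct (Nat.eq_dec k (S M)) as [->|Hne].
    + apply Rle_trans with (1 := HD i), Rmax_r.
    + apply Rle_trans with (2 := Rmax_l C D), HC. lia.
Qed.

Theorem theorem2
  (M : nat) (HM : (1 <= M)%nat) (x0 y0 : nat) (Hx0 : (x0 <= M)%nat)
  (lam : R -> nat -> R)
  (Hlam_nonneg : forall t x, 0 <= t -> (x <= M)%nat -> 0 <= lam t x)
  (Hlam_rc : forall x t, (x <= M)%nat -> 0 <= t ->
      filterlim (fun s => lam s x) (at_right t) (locally (lam t x)))
  (Hlam_ll : forall x t, (x <= M)%nat -> 0 < t ->
      exists l, filterlim (fun s => lam s x) (at_left t) (locally l))
  (Hlam_M : forall t, 0 <= t -> lam t M = 0)
  (Hlam_bdd : forall T, 0 < T -> exists C, forall t x,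
      0 <= t <= T -> (x <= M)%nat -> Rabs (lam t x) <= C)
  (f : R -> R)
  (Hf_cont : forall x, continuous f x)
  (Hf_bnd : exists fl fu, 0 < fl /\ forall x, fl <= f x <= fu)
  (mu : nat -> nat -> nat -> R)
  (Hmu_off : forall k i j, (k <= M)%nat -> i <> j -> 0 <= mu k i j)
  (Hmu_diag : forall k i, (k <= M)%nat -> mu k i i <= 0)
  (Hmu_row : forall k i, (k <= M)%nat -> is_series (fun j => mu k i j) 0)
  (Hmu_bdd : forall k, (k <= M)%nat -> exists C, forall i, Rabs (mu k i i) <= C) :
  (exists P : R -> lfamily,
      is_solution M lam f mu x0 y0 P /\ is_prob_path M P) /\
  (forall P Q : R -> lfamily,
      is_solution M lam f mu x0 y0 P -> is_prob_path M P ->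
      is_solution M lam f mu x0 y0 Q -> is_prob_path M Q ->
      forall t i j, 0 <= t -> (i <= M)%nat -> P t i j = Q t i j).
Proof.
  destruct Hf_bnd as [fl [fu [Hfl Hf]]].
  destruct (uniform_bound (fun k i => Rabs (mu k i i)) M Hmu_bdd) as [C HC].
  assert (Hm : model M lam f mu fl fu C).
  { split; auto.
    - intros i Hi. split; intros t Ht; eauto.
    - split; auto.
    - intros i Hi. repeat split; auto. }
  split.
  - apply model_existence with fl fu C; auto.
  - intros P Q HP HPp HQ HQp t i j Ht Hi.
    apply model_uniqueness with (1 := Hm) (2 := HP) (4 := HQ); auto.
Qed.
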